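(* Let $G=(V,E,\omega)$ be an infinite weighted graph as in the context, and let $p>1$, $q>0$. Assume that there exist constants $C>0$ and $d>0$ such that $$\mu_V(B_R)\le C(1+R)^d\quad\text{for all }R\ge0.$$ Further assume that $q(p-1)\ge\frac{d-p}{d}$. Let $u\in L^\infty([0,+\infty);\ell^1(V))$ be an exhaustion solution of $$\begin{cases}\partial_t u(x,t)=\Delta_p u^q(x,t), & x\in V,\ t>0,\\ u(x,0)=u_0(x), & x\in V,\end{cases}$$ with initial data $u_0\in\ell^1(V)$. Then for all $t>0$, $$\sum_{x\in V}u(x,t)\,\mu(x)=\sum_{x\in V}u_0(x)\,\mu(x).$$
   Context: Graph: $G=(V,E,\omega)$ is an infinite, connected, countable weighted graph with no multiple edges or self-loops; $\omega:V\times V\to[0,\infty)$ is symmetric and $\omega_{xy}=\omega(x,y)>0$ if and only if $\{x,y\}\in E$ (written $x\sim y$). Every vertex has finite degree, $\mu(x)=\sum_{y\sim x}\omega_{xy}$, and $\mu_0:=\inf_{x\in V}\mu(x)>0$. $\mu_V(U)=\sum_{x\in U}\mu(x)$ for $U\subset V$. $d(x,y)$ is the graph distance, $B_R(x_0)=\{x\in V: d(x,x_0)\le R\}$, and $B_R=B_R(x_0)$ for a fixed vertex $x_0\in V$. Norms: $\|f\|_{\ell^r(V)}=\big(\sum_{x\in V}|f(x)|^r\mu(x)\big)^{1/r}$ for $r\ge1$. Powers: for $k\in\mathbb R$, $s>0$, $k^s:=|k|^{s-1}k$ (so $0^s=0$). Operator: $\Delta_p u^q(x,t)=\frac1{\mu(x)}\sum_{y\in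 V}|u^q(y,t)-u^q(x,t)|^{p-2}(u^q(y,t)-u^q(x,t))\,\omega_{xy}$. Solution: a solution in $L^\infty([0,T);\ell^r(V))$ ($0<T\le+\infty$, $r\ge1$) is a function $u:V\times[0,T)\to\mathbb R$ with $u\in L^\infty([0,T);\ell^r(V))$, $u(x,\cdot)\in C^1([0,T))$ for all $x\in V$, satisfying the initial value problem pointwise. Exhaustion solution: fix $x_0\in V$. For $n\ge1$ consider the mixed problem $$\begin{cases}\partial_t u_n(x,t)=\Delta_p u_n^q(x,t), & x\in B_n(x_0),\ t>0,\\ u_n(x,0)=u_0(x), & x\in B_n(x_0),\\ u_n(x,t)=0,& x\notin B_n(x_0),\ t\ge0.\end{cases}$$ A solution $u\in L^\infty([0,+\infty);\ell^r(V))$ of the initial value problem is an exhaustion solution if there is a subsequence $n_k\to\infty$ with $u(x,t)=\lim_{k\to\infty}u_{n_k}(x,t)$ for all $(x,t)\in V\times[0,+\infty)$, where each $u_{n_k}$ is a solution of the mixed problem on $B_{n_k}(x_0)$. *)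

(* Defs.v *)
From HB Require Import structures.
From mathcomp Require Import all_boot all_order all_algebra.
From mathcomp Require Import all_classical all_reals all_analysis.

Set Implicit Arguments.
Unset Strict Implicit.
Unset Printing Implicit Defensive.

Import Order.TTheory GRing.Theory Num.Theory.
Import numFieldNormedType.Exports.

Local Open Scope classical_set_scope.
Local Open Scope ring_scope.

(** The edge set is [{x, y} | 0 < wgt x y]. *)
Record weighted_graph (R : realType) (V : countType) := WeightedGraph {
  wgt :> V -> V -> R;
  wgt_ge0 : forall x y, 0 <= wgt x y;
  wgt_sym : forall x y, wgt x y = wgt y x;
  wgt_irrefl : forall x, wgt x x = 0;
  wgt_locally_finite : forall x, finite_set [set y | 0 < wgt x y] }.

Section Graph.
Variables (R : realType) (V : countType) (G : weighted_graph R V).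

Definition adj : rel V := fun x y => 0 < G x y.

Definition walk (x y : V) (n : nat) : Prop :=
  exists s : seq V, [/\ path adj x s, last x s = y & size s = n].

Definition connected_graph : Prop := forall x y, exists n, walk x y n.

(** [+oo] when [x] and [y] lie in different components. *)
Definition gdist (x y : V) : \bar R :=
  ereal_inf [set (n%:R)%:E | n in walk x y].

Definition gball (x0 : V) (r : R) : set V := [set x | (gdist x x0 <= r%:E)%E].

Definition vmu (x : V) : R := \sum_(y \in [set y | adj x y]) G x y.

Definition vmu_set (U : set V) : \bar R := \esum_(x in U) (vmu x)%:E.

(** The signed sum of [f x * vmu x] over all vertices. When the positive or the
    negative part is summable, this is the unconditional sum; in particular it
    is finite exactly when the family is absolutely summable. *)
Definition vsum (f : V -> R) : \bar R :=
  let g := fun x => (f x * vmu x)%:E in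
  (\esum_(x in [set: V]) (g^\+ x) - \esum_(x in [set: V]) (g^\- x))%E.

Definition lr_norm (r : R) (f : V -> R) : \bar R :=
  ((\esum_(x in [set: V]) (`|f x| `^ r * vmu x)%:E) `^ r^-1)%E.

Definition in_lr (r : R) (f : V -> R) : Prop := (lr_norm r f < +oo)%E.

(** [k^s] in the signed convention; [k = 0] gives [0] for every [s]. *)
Definition spow (k s : R) : R := `|k| `^ (s - 1) * k.

(** The finitely supported sum runs over all of [V]: the summand vanishes
    unless [y] is a neighbour of [x]. *)
Definition plaplace (p : R) (f : V -> R) (x : V) : R :=
  (vmu x)^-1 *
  \sum_(y \in [set: V]) (`|f y - f x| `^ (p - 2) * (f y - f x) * G x y).

Definition time_interval (T : \bar R) : set R := [set t | 0 <= t /\ (t%:E < T)%E].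

(** Coordinatewise measurability is strong measurability into [l^r(V)], since
    [V] is countable and [r] is finite. *)
Definition Linfty_lr (T : \bar R) (r : R) (u : V -> R -> R) : Prop :=
  (forall x, measurable_fun (time_interval T) (u x)) /\
  exists M : R, {ae lebesgue_measure, forall t : R,
    time_interval T t -> (lr_norm r (u^~ t) <= M%:E)%E}.

(** Difference quotients are taken inside [0, T), so that the derivative at the
    endpoint [0] is one-sided. *)
Definition C1_on (T : \bar R) (f : R -> R) : Prop :=
  exists df : R -> R, {within time_interval T, continuous df} /\
    forall t, time_interval T t ->
      (f s - f t) / (s - t) @[s --> within (time_interval T) t^'] --> df t.

Definition is_solution (p q : R) (T : \bar R) (r : R) (u0 : V -> R)
    (u : V -> R -> R) : Prop :=
  [/\ Linfty_lr T r u,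
      forall x, C1_on T (u x),
      forall (x : V) (t : R), 0 < t -> (t%:E < T)%E ->
        is_derive t (1 : R) (u x) (plaplace p (fun y => spow (u y t) q) x) &
      forall x, u x 0 = u0 x].

Definition is_mixed_solution (p q : R) (U : set V) (u0 : V -> R)
    (u : V -> R -> R) : Prop :=
  [/\ forall x, C1_on +oo%E (u x),
      forall (x : V) (t : R), U x -> 0 < t ->
        is_derive t (1 : R) (u x) (plaplace p (fun y => spow (u y t) q) x),
      forall x, U x -> u x 0 = u0 x &
      forall (x : V) (t : R), ~ U x -> 0 <= t -> u x t = 0].

Definition is_exhaustion_solution (p q : R) (x0 : V) (r : R) (u0 : V -> R)
    (u : V -> R -> R) : Prop :=
  is_solution p q +oo%E r u0 u /\
  exists (n : nat -> nat) (un : nat -> V -> R -> R),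
    [/\ {homo n : i j / (i < j)%N},
        forall k, (1 <= n k)%N,
        forall k, is_mixed_solution p q (gball x0 (n k)%:R) u0 (un k) &
        forall (x : V) (t : R), 0 <= t -> un k x t @[k --> \oo] --> u x t].

End Graph.

(* Main.v *)
Require Import Defs.
From HB Require Import structures.
From mathcomp Require Import all_boot all_order all_algebra.
From mathcomp Require Import all_classical all_reals all_analysis.
From mathcomp Require Import ring lra.

Import Order.TTheory GRing.Theory Num.Theory.
Import numFieldNormedType.Exports.

Local Open Scope classical_set_scope.
Local Open Scope ring_scope.

Set Implicit Arguments.
Unset Strict Implicit.
Unset Printing Implicit Defensive.

(** Mass can only be lost at infinity, so the equation is tested with a finitely
    supported cutoff [eta], and the flux through the region where [eta] varies has
    to be small. All estimates are made for the approximating solutions on balls,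
    where every sum is finite, and do not depend on the ball. The given solution is
    only used as their pointwise limit at one time.

    Write [J] for the flux of [u^q] through an edge. A direct estimate of the
    sum of [|J| |grad eta|] gains only one power of the radius, whereas the
    condition on the exponents asks for [p] powers. The missing decay comes from
    entropy dissipation: testing with [eta + lam u^s], for a small exponent [s],
    makes the sum of [eta u + lam |u|^(1+s) / (1+s)] grow at a rate given by minus
    the sum over edges of [J (grad eta + lam grad u^s)], where [J grad u^s >= 0].
    On each edge, either [|grad eta| <= lam |grad u^s|] and the contribution has
    the good sign, or [grad u^s] is small, and then so is [grad u^q], because
    [u^q] is a Lipschitz function of [u^s] ([spow_diff_le]). What remains is
    [(q M^(q-s) / (s lam))^(p-1) |grad eta|^p], with [M] the larger of the two
    values of [|u|] ([flux_entropy_le], [functional_growth]).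

    With [eta = 0] and [s] tending to [0] this gives the contraction of the l^1
    norm, hence a uniform bound, as vertex masses are bounded below
    ([mixed_l1_contraction], [mixed_bounded]). It also bounds the initial
    entropy by a constant that does not depend on [s].

    In the equality case of the condition on the exponents any fixed [s > 0]
    loses a small power of the radius. Hence [s = 1 / L], together with a cutoff
    that decreases logarithmically up to the radius [e^L], where [R^s] is bounded.
    Interpolating between the l^1 bound and the volume growth at the density
    [kappa R^(-d)], the total remainder is of order
    [lam^(1-p) (1 / (kappa L) + kappa^(alpha/2))] for some [alpha > 0]
    ([weight_le], [remainder_le]). The change of cutoff mass is thus at most a
    constant times [lam], plus this remainder; choosing [lam] small, then [kappa],
    then [L] large makes it arbitrarily small ([mixed_mass_defect]). *)

(** * Signed powers and the flux through one edge *)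

Section Powers.
Variable R : realType.
Implicit Types eta lam p a b k q r s x y z : R.

Lemma powR_diff_le r x y : 1 <= r -> 0 <= x -> x <= y ->
  y `^ r - x `^ r <= r * y `^ (r - 1) * (y - x).
Proof.
move=> r1 x0; rewrite le_eqVlt => /predU1P[->|xy]; first by rewrite !subrr mulr0.
have y0 : 0 < y by exact: le_lt_trans xy.
have r0 : 0 < r by exact: lt_le_trans r1.
move: x0; rewrite le_eqVlt => /predU1P[<-|x0].
  rewrite powR0 ?gt_eqF// !subr0 -mulrA [_ * y]mulrC mulr_powRB1 ?(ltW y0)//.
  by rewrite ler_peMl// powR_ge0.
have D c : c \in `]x, y[ -> is_derive c 1 (fun z => z `^ r) (r * c `^ (r - 1)).
  by rewrite in_itv/= => /andP[xc _]; apply: is_derive1_powR; exact: lt_trans xc.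
have [|c] := MVT xy D.
  apply: derivable_within_continuous => c; rewrite in_itv/= => /andP[xc _].
  by have [] := is_derive1_powR r (lt_le_trans x0 xc).
rewrite in_itv/= => /andP[xc cy] ->.
have c0 := lt_trans x0 xc.
rewrite ler_wpM2r ?subr_ge0 ?(ltW xy)// ler_wpM2l ?(ltW r0)//.
by rewrite ge0_ler_powR ?nnegrE ?subr_ge0 ?(ltW c0) ?(ltW y0) ?(ltW cy).
Qed.

Lemma spow0 s : spow 0 s = 0. Proof. by rewrite /spow mulr0. Qed.

Lemma spowN k s : spow (- k) s = - spow k s.
Proof. by rewrite /spow normrN mulrN. Qed.

Lemma spow_ge0E k s : 0 < s -> 0 <= k -> spow k s = k `^ s.
Proof.
by move=> s0 k0; rewrite /spow ger0_norm// mulrC mulr_powRB1.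
Qed.

Lemma norm_spow k s : 0 < s -> `|spow k s| = `|k| `^ s.
Proof.
move=> s0; rewrite /spow normrM norm_powR// normr_id mulrC.
by rewrite mulr_powRB1.
Qed.

Lemma le_spow s x y : 0 < s -> x <= y -> spow x s <= spow y s.
Proof.
move=> s0 xy.
have pos a b : 0 <= a -> a <= b -> spow a s <= spow b s.
  move=> a0 ab; have b0 := le_trans a0 ab.
  by rewrite !spow_ge0E// ge0_ler_powR// ?nnegrE// ltW.
have [x0|x0] := leP 0 x; first exact: pos.
have [y0|y0] := leP y 0.
  by rewrite -lerN2 -!spowN pos ?oppr_ge0// lerN2.
apply: (@le_trans _ _ 0); last by rewrite spow_ge0E ?powR_ge0// ltW.
by rewrite -[x]opprK spowN oppr_le0 spow_ge0E ?powR_ge0// oppr_ge0 ltW.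
Qed.

Lemma spow_diff_le_ordered s q x y : 0 < s -> s < q -> x <= y ->
  spow y q - spow x q <=
    q / s * Num.max `|x| `|y| `^ (q - s) * (spow y s - spow x s).
Proof.
move=> s0 sq xy; have q0 := lt_trans s0 sq.
have qs1 : 1 <= q / s by rewrite ler_pdivlMr// mul1r ltW.
have qs0 : 0 <= q - s by rewrite subr_ge0 ltW.
have powE a : (a `^ s) `^ (q / s) = a `^ q.
  by rewrite -powRrM mulrCA divff ?mulr1// gt_eqF.
have powE' a : (a `^ s) `^ (q / s - 1) = a `^ (q - s).
  by rewrite -powRrM mulrBr mulrCA divff ?mulr1// gt_eqF.
have pos a b : 0 <= a -> a <= b -> spow b q - spow a q <=
    q / s * Num.max `|a| `|b| `^ (q - s) * (spow b s - spow a s).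
  move=> a0 ab; have b0 := le_trans a0 ab.
  rewrite !spow_ge0E// !ger0_norm// max_r//.
  have := @powR_diff_le (q / s) (a `^ s) (b `^ s) qs1 (powR_ge0 _ _).
  by rewrite !powE powE'; apply; rewrite ge0_ler_powR// ?nnegrE// ltW.
have [x0|x0] := leP 0 x; first exact: pos.
have [y0|y0] := leP y 0.
  have := @pos (- y) (- x); rewrite !spowN !normrN maxC !opprK.
  rewrite [- _ + _ in X in X -> _]addrC [- _ + spow _ s in X in X -> _]addrC.
  by apply; rewrite ?oppr_ge0 ?lerN2.
have negE a : 0 < a -> spow x a = - `|x| `^ a.
  by move=> a0; rewrite ltr0_norm// -{1}[x]opprK spowN spow_ge0E// oppr_ge0 ltW.
have posE a : 0 < a -> spow y a = `|y| `^ a.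
  by move=> a0; rewrite gtr0_norm// spow_ge0E// ltW.
rewrite !negE// !posE// !opprK.
set M := Num.max _ _.
have le1 a : 0 <= a -> a <= M -> a `^ q <= M `^ (q - s) * a `^ s.
  move=> a0 aM; have -> : a `^ q = a `^ (q - s) * a `^ s.
    by rewrite -powRD ?subrK// gt_eqF.
  apply: ler_wpM2r; first exact: powR_ge0.
  by rewrite ge0_ler_powR// nnegrE (le_trans a0).
apply: (@le_trans _ _ (M `^ (q - s) * (`|y| `^ s + `|x| `^ s))).
  by rewrite mulrDr lerD// le1// /M le_max lexx ?orbT.
rewrite -mulrA ler_peMl// mulr_ge0 ?addr_ge0 ?powR_ge0//.
Qed.

(** [spow _ q] is the signed power of exponent [q / s >= 1] of [spow _ s], and
    [q / s * M `^ (q - s)] is the Lipschitz constant of that power on the values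
    taken by [spow _ s] on [-M, M]. *)
Lemma spow_diff_le s q x y : 0 < s -> s < q ->
  `|spow y q - spow x q| <=
    q / s * Num.max `|x| `|y| `^ (q - s) * `|spow y s - spow x s|.
Proof.
move=> s0 sq; have q0 := lt_trans s0 sq.
wlog xy : x y / x <= y.
  move=> H; have [/H//|/ltW /H] := leP x y.
  by rewrite maxC distrC [X in _ <= _ * X]distrC.
rewrite [X in X <= _]ger0_norm ?[X in _ * X]ger0_norm ?subr_ge0 ?le_spow//.
exact: spow_diff_le_ordered.
Qed.

(** The left-hand side is the rate at which one edge feeds mass plus [lam] times
    entropy: [eta] stands for the increment of the cutoff, and the product of
    the flux with the increment of [spow _ s] is the entropy dissipation, which
    is nonnegative. Comparing [eta] with the increment of [spow _ s] replaces
    Young's inequality and needs no chain rule for differences. *)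
Lemma flux_entropy_le p q s lam eta x y : 1 < p -> 0 < s -> s < q -> 0 < lam ->
  - (spow (spow y q - spow x q) (p - 1) *
       (eta + lam * (spow y s - spow x s))) <=
  (q / s * Num.max `|x| `|y| `^ (q - s) / lam) `^ (p - 1) * `|eta| `^ p.
Proof.
move=> p1 s0 sq lam0; have q0 := lt_trans s0 sq.
have p10 : 0 < p - 1 by rewrite subr_gt0.
have p0 : 0 < p by exact: lt_trans p1.
set A := spow y q - spow x q; set B := spow y s - spow x s.
set J := spow A (p - 1); set K := q / s * _.
have K0 : 0 <= K by rewrite mulr_ge0 ?powR_ge0// divr_ge0 ?ltW.
have JB : J * B = `|J| * `|B|.
  rewrite -normrM ger0_norm// /J /A /B; have [xy|/ltW xy] := leP x y.
    by rewrite mulr_ge0 ?subr_ge0 ?le_spow// -(spow0 (p - 1)) le_spow// subr_ge0 le_spow.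
  rewrite mulr_le0 ?subr_le0 ?le_spow// -(spow0 (p - 1)) le_spow//.
  by rewrite subr_le0 le_spow.
rewrite mulrDr mulrCA JB opprD.
have JE : `|J| = `|A| `^ (p - 1) by rewrite norm_spow.
apply: (@le_trans _ _ (`|J| * (`|eta| - lam * `|B|))).
  by rewrite mulrBr [X in _ - X]mulrCA lerD2r -normrM -normrN ler_norm.
have rhs0 : 0 <= (K / lam) `^ (p - 1) * `|eta| `^ p.
  by rewrite mulr_ge0 ?powR_ge0.
(* Either the dissipation already beats the flux, or the increment [B] is
   smaller than [eta / lam]; then so is [A], up to the factor [K]. *)
have [h|h] := leP `|eta| (lam * `|B|).
  by apply: le_trans rhs0; rewrite mulr_ge0_le0// subr_le0.
apply: (@le_trans _ _ (`|J| * `|eta|)).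
  by rewrite ler_wpM2l// gerBl mulr_ge0// ltW.
have -> : `|eta| `^ p = `|eta| `^ (p - 1) * `|eta|.
  by rewrite [RHS]mulrC mulr_powRB1.
have KL0 : 0 <= K / lam by rewrite divr_ge0// ltW.
rewrite mulrA ler_wpM2r// JE -powRM//.
apply: ge0_ler_powR; rewrite ?nnegrE ?(mulr_ge0 KL0)// ?(ltW p10)//.
rewrite (le_trans (spow_diff_le _ _ s0 sq))// -/K -mulrA ler_wpM2l//.
by rewrite mulrC ler_pdivlMr// mulrC ltW.
Qed.

(** The convex primitive of [spow _ s]. *)
Definition entropy s z := `|z| `^ (1 + s) / (1 + s).

Lemma entropy_ge0 s z : 0 < s -> 0 <= entropy s z.
Proof. by move=> s0; rewrite divr_ge0 ?powR_ge0// addr_ge0// ltW. Qed.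

Lemma entropy0 s : 0 < s -> entropy s 0 = 0.
Proof.
by move=> s0; rewrite /entropy normr0 powR0 ?mul0r// gt_eqF// addr_gt0.
Qed.

Lemma is_derive_cvg (f : R -> R) x l :
  h^-1 * (f (h + x) - f x) @[h --> 0^'] --> l -> is_derive x 1 f l.
Proof.
move=> H.
have E : (fun h : R => h^-1 *: ((f \o shift x) (h *: (1 : R)) - f x)) =
    (fun h => h^-1 * (f (h + x) - f x)).
  by apply/funext => h /=; rewrite /GRing.scale/= mulr1.
apply: DeriveDef; first by rewrite /derivable E; apply: cvgP H.
by rewrite /derive E; exact: cvg_lim H.
Qed.

Lemma powR_norm_cvg0 s : 0 < s -> `|h| `^ s @[h --> (0 : R)] --> (0 : R).
Proof.
move=> s0; apply/cvgr0Pnorm_lt => e e0.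
near=> h.
rewrite norm_powR// normr_id.
have -> : e = (e `^ s^-1) `^ s by rewrite -powRrM mulVf ?powRr1 ?gt_eqF// ltW.
rewrite gt0_ltr_powR ?nnegrE ?powR_ge0//.
near: h; apply: (@nbhs0_lt R R); rewrite powR_gt0//.
Unshelve. all: by end_near.
Qed.

Lemma is_derive_entropy s z : 0 < s -> is_derive z 1 (entropy s) (spow z s).
Proof.
move=> s0; have s10 : 0 < 1 + s by rewrite addr_gt0.
have pos x : 0 < x -> is_derive x 1 (fun y => y `^ (1 + s) / (1 + s)) (x `^ s).
  move=> x0; have D := is_derive1_powR (1 + s) x0.
  apply: is_derive_eq.
  by rewrite scaler0 add0r /GRing.scale/= mulrA mulVf ?gt_eqF// mul1r addrC addKr.
have [z0|z0|->] := ltgtP z 0; last first.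
- rewrite spow0; apply: is_derive_cvg.
  have H : `|h| `^ s / (1 + s) @[h --> (0:R)^'] --> (0 : R).
    rewrite -[X in _ --> X](mul0r (1 + s)^-1); apply: cvgMl.
    exact: cvg_trans (cvg_app _ (@nbhs_dnbhs _ (0 : R))) (powR_norm_cvg0 s0).
  apply/cvgr0Pnorm_lt => e e0; move/cvgr0Pnorm_lt: H => /(_ e e0).
  apply: filterS => h.
  rewrite addr0 entropy0// subr0 /entropy.
  rewrite !normrM !normfV !norm_powR// !normr_id.
  have [->|h0] := eqVneq h 0; first by rewrite normr0 invr0 mul0r.
  have -> : `|h| `^ (1 + s) = `|h| * `|h| `^ s.
    by rewrite -[LHS]mulr_powRB1// [1 + s]addrC addrK.
  by rewrite -mulrA mulrA mulVf ?mul1r ?normr_eq0.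
- rewrite spow_ge0E ?(ltW z0)//.
  apply: near_eq_is_derive (pos _ z0).
  by near=> y; rewrite /entropy gtr0_norm//; near: y; exact: lt_nbhsr.
- have N0 : 0 < - z by rewrite oppr_gt0.
  have -> : spow z s = ((- z) `^ s) * -1.
    by rewrite -{1}[z]opprK spowN spow_ge0E ?ltW// mulrN1.
  have D : is_derive z 1 (fun y => (- y) `^ (1 + s) / (1 + s)) ((- z) `^ s * -1).
    apply: (is_derive1_comp (pos _ N0)).
  apply: near_eq_is_derive D.
  by near=> y; rewrite /entropy ltr0_norm//; near: y; exact: lt_nbhsl.
Unshelve. all: by end_near.
Qed.

End Powers.

(** * Vertex masses, distance and finite balls *)

Section Graph.
Variables (R : realType) (V : countType) (G : weighted_graph R V).

Lemma wgt_adj0 x y : ~ adj G x y -> G x y = 0.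
Proof.
move=> /negP; rewrite /adj -leNgt => h; apply/eqP.
by rewrite eq_le h wgt_ge0.
Qed.

Lemma adj_sym x y : adj G x y = adj G y x.
Proof. by rewrite /adj wgt_sym. Qed.

Lemma vmuE x (D : seq V) : uniq D -> (forall y, adj G x y -> y \in D) ->
  vmu G x = \sum_(y <- D) G x y.
Proof.
move=> uD sub; apply: fsbig_fwiden => //.
by move=> y [/= _ /wgt_adj0].
Qed.

Lemma ler_sum_subset (D E : seq V) (F : V -> R) :
  uniq D -> {subset D <= E} -> (forall x, 0 <= F x) ->
  \sum_(x <- D) F x <= \sum_(x <- E) F x.
Proof.
move=> uD DE F0.
have H : \sum_(x <- undup E) F x <= \sum_(x <- E) F x.
  elim: E {DE} => //= a E IH; rewrite big_cons; case: ifP => _.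
    by rewrite (le_trans IH)// lerDr.
  by rewrite big_cons lerD2l.
apply: le_trans H.
have -> : \sum_(x <- D) F x = \sum_(x <- undup E | x \in D) F x.
  rewrite -[RHS]big_filter; apply: perm_big; apply: uniq_perm => //.
    by rewrite filter_uniq// undup_uniq.
  move=> x; rewrite mem_filter mem_undup.
  by have [/DE ->|] := boolP (x \in D).
by rewrite [leRHS](bigID (mem D))/= lerDl sumr_ge0.
Qed.

Lemma sum_wgt_le x (D : seq V) : uniq D -> \sum_(y <- D) G x y <= vmu G x.
Proof.
move=> uD; have fin := wgt_locally_finite G x.
pose E := finmap.enum_fset (fset_set [set y | 0 < G x y]).
rewrite (@vmuE x (undup (D ++ E))) ?undup_uniq//.
  apply: ler_sum_subset => // [y yD|y]; last exact: wgt_ge0.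
  by rewrite mem_undup mem_cat yD.
by move=> y xy; rewrite mem_undup mem_cat in_fset_set// mem_set ?orbT.
Qed.

Lemma vmu_ge0 x : 0 <= vmu G x.
Proof. by apply: fsumr_ge0 => y _; exact: wgt_ge0. Qed.

Lemma inf_vmu_le x : inf (range (vmu G)) <= vmu G x.
Proof.
apply: ge_inf; last by exists x.
by exists 0 => _ [y _ <-]; exact: vmu_ge0.
Qed.

(** Replaces the extended real distance to [x0] by a natural number. All that
    is used about distances afterwards is that it describes the balls and
    changes by at most one along an edge. *)
Lemma exists_depth (x0 : V) : connected_graph G ->
  exists rho : V -> nat,
    (forall x r, gball G x0 r x <-> (rho x)%:R <= r) /\
    (forall x y, adj G x y -> (rho y <= (rho x).+1)%N).
Proof.
move=> conn.
have ex x : exists n, `[< walk G x x0 n >].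
  by have [n] := conn x x0; exists n; apply/asboolP.
pose rho x := ex_minn (ex x).
have rho_walk x : walk G x x0 (rho x).
  by rewrite /rho; case: ex_minnP => n /asboolP.
have rho_min x n : walk G x x0 n -> (rho x <= n)%N.
  by rewrite /rho; case: ex_minnP => m _ + /asboolP w; apply.
have gdistE x : gdist G x x0 = (rho x)%:R%:E.
  apply/eqP; rewrite eq_le; apply/andP; split.
    by apply: ereal_inf_lbound; exists (rho x).
  by apply: le_ereal_inf_tmp => _ [n /rho_min h <-]; rewrite lee_fin ler_nat.
exists rho; split=> [x r|x y xy]; first by rewrite /gball/= gdistE lee_fin.
have [s [ps ls ss]] := rho_walk x; apply: rho_min.
by exists (x :: s); split; rewrite //= ?ss// adj_sym xy.
Qed.

Lemma fsets_sum_le_esum (U : set V) (F : V -> R) (D : seq V) :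
  uniq D -> (forall x, x \in D -> U x) -> (forall x, 0 <= F x) ->
  ((\sum_(x <- D) F x)%:E <= \esum_(x in U) (F x)%:E)%E.
Proof.
move=> uD DU F0; rewrite -sumEFin; apply: esum_ge.
exists [set` D]; last by rewrite -fsbig_seq.
by split; [exact: finite_seq|move=> x /DU].
Qed.

(** Every vertex carries at least the mass [inf (range (vmu G))], so a bound on
    the volume bounds the number of vertices. *)
Lemma volume_finite (U : set V) (M : R) : 0 < inf (range (vmu G)) ->
  (vmu_set G U <= M%:E)%E -> finite_set U.
Proof.
move=> m0 vol; apply: contrapT => infU.
set m := inf _ in m0.
pose n := (Num.truncn (M / m)).+1.
have [D DU nD] := infinite_set_fset n infU.
have : ((\sum_(x <- finmap.enum_fset D) vmu G x)%:E <= M%:E)%E.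
  apply: le_trans vol; apply: fsets_sum_le_esum vmu_ge0 => [|x /DU//].
  exact: finmap.fset_uniq.
rewrite lee_fin leNgt => /negP; apply.
apply: (@lt_le_trans _ _ (n%:R * m)).
  by rewrite -ltr_pdivrMr// truncnS_gt.
apply: (@le_trans _ _ (\sum_(x <- finmap.enum_fset D) m)).
  rewrite big_const_seq count_predT iter_addr addr0 -[leRHS]mulr_natl.
  by rewrite ler_wpM2r ?ler_nat// ltW.
by apply: ler_sum => x _; exact: inf_vmu_le.
Qed.

End Graph.

(** * Growth of mass plus entropy *)

Section Calculus.
Variable R : realType.

Lemma is_derive_sum_seq (T : Type) (D : seq T) (f : T -> R -> R) (df : T -> R) (t : R) :
  (forall x, is_derive t (1 : R) (f x) (df x)) ->
  is_derive t (1 : R) (fun r => \sum_(x <- D) f x r) (\sum_(x <- D) df x).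
Proof.
move=> fdf; elim: D => [|x D IH].
  under eq_fun do rewrite big_nil.
  by rewrite big_nil; exact: is_derive_cst.
under eq_fun do rewrite big_cons.
by rewrite big_cons; exact: is_deriveD.
Qed.

Lemma cvg_sum_seq (T : Type) (D : seq T) (S : Type) (F : set_system S)
    {FF : Filter F} (f : T -> S -> R) (l : T -> R) :
  (forall x, f x r @[r --> F] --> l x) ->
  \sum_(x <- D) f x r @[r --> F] --> \sum_(x <- D) l x.
Proof.
move=> fl; elim: D => [|x D IH].
  under eq_fun do rewrite big_nil.
  by rewrite big_nil; exact: cvg_cst.
under eq_fun do rewrite big_cons.
by rewrite big_cons; exact: cvgD.
Qed.

Lemma C1_cvg_at0 (f : R -> R) : C1_on +oo%E f -> f r @[r --> 0^'+] --> f 0.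
Proof.
move=> [df [_ /(_ 0)]]; rewrite /time_interval/= lexx ltry => /(_ (conj isT isT)) H.
have {}H : (f r - f 0) / (r - 0) @[r --> 0^'+] --> df 0.
  apply: cvg_trans H; apply: cvg_app => S h.
  change (\forall x \near (0 : R), x != 0 -> 0 <= x /\ (x%:E < +oo)%E -> S x) in h.
  change (\forall x \near (0 : R), 0 < x -> S x).
  near=> x => x0; have : x != 0 -> 0 <= x /\ (x%:E < +oo)%E -> S x by near: x.
  by apply; [rewrite gt_eqF|split; [exact: ltW|exact: ltry]].
have id0 : r @[r --> (0:R)^'+] --> (0 : R) by exact: cvg_within.
have L : f 0 + (f r - f 0) / (r - 0) * r @[r --> 0^'+] --> f 0.
  rewrite -[X in _ --> X]addr0 -[X in _ + X](mulr0 (df 0)).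
  by apply: cvgD; [exact: cvg_cst|exact: cvgM].
apply: cvg_trans L; apply: near_eq_cvg.
near=> r; rewrite /= subr0 mulfVK ?subrKC//.
Unshelve. all: by end_near.
Qed.

(** The derivative need only exist for positive times, as in the equation; at
    time [0] right continuity is enough for the mean value theorem. *)
Lemma growth_le (f df : R -> R) (t W : R) : 0 < t ->
  (forall r : R, 0 < r -> is_derive r (1 : R) f (df r)) -> f r @[r --> 0^'+] --> f 0 ->
  (forall r : R, 0 < r -> r < t -> df r <= W) -> f t <= f 0 + t * W.
Proof.
move=> t0 fdf f0 dfW.
have cont r : 0 < r -> {for r, continuous f}.
  move=> r0; apply: differentiable_continuous; apply/derivable1_diffP.
  by case: (fdf r r0).
have [||c] := @MVT R f df 0 t t0.
- by move=> r; rewrite in_itv/= => /andP[r0 _]; exact: fdf.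
- apply/continuous_within_itvP => //; split=> //.
    by move=> r; rewrite in_itv/= => /andP[r0 _]; exact: cont.
  by apply: cvg_at_left_filter; exact: cont.
rewrite in_itv/= subr0 => /andP[c0 ct] e.
by rewrite -lerBlDl e mulrC ler_wpM2l ?(ltW t0)// dfW.
Qed.
End Calculus.

Section Graph.
Variables (R : realType) (V : countType) (G : weighted_graph R V).

(** Summation by parts: the flux through an edge is an antisymmetric function
    of its endpoints. *)
Lemma sum_antisym (D : seq V) (J : V -> V -> R) (psi : V -> R) :
  (forall x y, J y x = - J x y) ->
  \sum_(x <- D) psi x * \sum_(y <- D) J x y =
  2^-1 * \sum_(x <- D) \sum_(y <- D) - (J x y * (psi y - psi x)).
Proof.
move=> Jas.
have -> : \sum_(x <- D) \sum_(y <- D) - (J x y * (psi y - psi x)) =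
    \sum_(x <- D) \sum_(y <- D) J y x * psi y +
    \sum_(x <- D) \sum_(y <- D) J x y * psi x.
  rewrite -big_split/=; apply: eq_bigr => x _.
  rewrite -big_split/=; apply: eq_bigr => y _.
  by rewrite [J y x]Jas; ring.
rewrite [X in X + _]exchange_big/=.
have -> : \sum_(x <- D) \sum_(y <- D) J x y * psi x =
    \sum_(x <- D) psi x * \sum_(y <- D) J x y.
  apply: eq_bigr => x _; rewrite mulr_sumr; apply: eq_bigr => y _.
  by rewrite mulrC.
by field.
Qed.

Lemma plaplaceE p (f : V -> R) x (D : seq V) : uniq D ->
  (forall y, adj G x y -> y \in D) ->
  plaplace G p f x =
  (vmu G x)^-1 * \sum_(y <- D) spow (f y - f x) (p - 1) * G x y.
Proof.
move=> uD sub; congr (_ * _).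
rewrite (fsbigE D)//=; last first.
  by move=> y _ yD; rewrite wgt_adj0 ?mulr0// => /sub; apply/negP.
apply: eq_big => [y|y _]; first by rewrite in_setT.
by rewrite /spow; congr (_ `^ _ * _ * _); ring.
Qed.

(** [D] is a finite set of vertices that contains every neighbour of [U], so
    that sums over [D] see the whole flux out of each vertex of [U]. *)
Section MixedSolution.
Variables (p q s lam : R) (U : set V) (D : seq V) (u0 : V -> R).
Variables (u : V -> R -> R) (eta : V -> R).
Hypotheses (p_gt1 : 1 < p) (s_gt0 : 0 < s) (s_lt_q : s < q).
Hypotheses (lam_gt0 : 0 < lam) (vmu_gt0 : forall x, 0 < vmu G x).
Hypotheses (D_uniq : uniq D) (U_nbh : forall x y, U x -> adj G x y -> y \in D).
Hypothesis u_sol : is_mixed_solution G p q U u0 u.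
Hypothesis eta_off : forall x, ~ U x -> eta x = 0.

Let functional t :=
  \sum_(x <- D) (eta x * u x t + lam * entropy s (u x t)) * vmu G x.

(* The derivative of the [x]-summand of [functional] with respect to [u x t]. *)
Let psi t x := eta x + lam * spow (u x t) s.

(* Off [U] the function [u x] is constantly [0], hence so is its derivative. *)
Let du t x := if `[< U x >] then plaplace G p (fun y => spow (u y t) q) x else 0.

Let is_derive_u x (t : R) : 0 < t -> is_derive t (1 : R) (u x) (du t x).
Proof.
move=> t0; have [_ eqn _ off] := u_sol; rewrite /du; case: asboolP => [Ux|nUx].
  exact: eqn.
apply: near_eq_is_derive (is_derive_cst (0 : R) t 1).
by near=> r; rewrite off// ltW//; near: r; exact: lt_nbhsr.
Unshelve. all: by end_near.
Qed.

Let is_derive_functional (t : R) : 0 < t ->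
  is_derive t (1 : R) functional (\sum_(x <- D) psi t x * (du t x * vmu G x)).
Proof.
move=> t0; apply: is_derive_sum_seq => x.
have Du := is_derive_u x t0.
have De := is_derive1_comp (is_derive_entropy (u x t) s_gt0) Du.
apply: is_derive_eq.
by rewrite /psi /GRing.scale/=; ring.
Qed.

Let functional_cvg0 : functional r @[r --> 0^'+] --> functional 0.
Proof.
apply: cvg_sum_seq => x.
have [C1 _ _ _] := u_sol; have ux := C1_cvg_at0 (C1 x).
apply: cvgMl; apply: cvgD; first exact: cvgMr.
apply: cvgMr; apply: (cvg_comp _ _ ux).
apply: differentiable_continuous; apply/derivable1_diffP.
by case: (is_derive_entropy (u x 0) s_gt0).
Qed.

(** Testing the equation with [eta + lam * spow u s], which vanishes off [U], and
    summing by parts turns the derivative of [functional] into a sum over edges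
    that [flux_entropy_le] bounds term by term. *)
Lemma functional_growth t W : 0 < t ->
  (forall r, 0 < r -> r < t -> 2^-1 * \sum_(x <- D) \sum_(y <- D)
     (q / s * Num.max `|u x r| `|u y r| `^ (q - s) / lam) `^ (p - 1) *
     `|eta y - eta x| `^ p * G x y <= W) ->
  functional t <= functional 0 + t * W.
Proof.
move=> t0 HW.
apply: (growth_le t0 is_derive_functional functional_cvg0) => r r0 rt.
apply: le_trans (HW r r0 rt); have [_ _ _ off] := u_sol.
set v := fun y => spow (u y r) q.
have -> : \sum_(x <- D) psi r x * (du r x * vmu G x) =
    \sum_(x <- D) psi r x * \sum_(y <- D) spow (v y - v x) (p - 1) * G x y.
  apply: eq_bigr => x _; rewrite /du; case: asboolP => [Ux|nUx].
    rewrite (plaplaceE _ _ D_uniq (fun y => @U_nbh x y Ux)) mulrAC.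
    by rewrite mulVf ?mul1r// gt_eqF.
  by rewrite /psi eta_off// off ?(ltW r0)// spow0 mulr0 addr0 !mul0r.
rewrite (sum_antisym _ (J := fun x y => spow (v y - v x) (p - 1) * G x y)); last first.
  by move=> x y; rewrite (wgt_sym G y x) -[v x - v y]opprB spowN mulNr.
rewrite ler_wpM2l ?invr_ge0//.
apply: ler_sum => x _; apply: ler_sum => y _.
rewrite mulrAC -mulNr ler_wpM2r ?wgt_ge0//.
have -> : psi r y - psi r x =
  (eta y - eta x) + lam * (spow (u y r) s - spow (u x r) s).
  by rewrite /psi; ring.
exact: flux_entropy_le.
Qed.

End MixedSolution.

End Graph.

(** * Contraction in l^1 and uniform bounds *)

Lemma powR_exponent_cvg (R : realType) (a : R) : 0 <= a ->
  a `^ (1 + s) @[s --> 0^'+] --> a.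
Proof.
rewrite le_eqVlt => /predU1P[<-|a0].
  apply: cvg_near_cst; near=> s.
  have s0 : 0 < s by near: s; exact: nbhs_right_gt.
  by rewrite powR0 ?gt_eqF ?addr_gt0.
have -> : (fun s => a `^ (1 + s)) = (fun s => expR ((1 + s) * ln a)).
  by apply/funext => s; rewrite /powR gt_eqF.
have aE : expR ((1 + 0) * ln a) = a by rewrite addr0 mul1r lnK// posrE.
rewrite -[X in _ --> X]aE; apply: continuous_cvg; first exact: continuous_expR.
apply: cvgMl; apply: cvgD; first exact: cvg_cst.
exact: cvg_within.
Unshelve. all: by end_near.
Qed.

Section L1.
Variables (R : realType) (V : countType) (G : weighted_graph R V).
Variables (p q S m : R) (U : set V) (D : seq V) (u0 : V -> R).
Variables (u : V -> R -> R).
Hypotheses (p_gt1 : 1 < p) (q_gt0 : 0 < q).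
Hypotheses (m_gt0 : 0 < m) (vmu_gem : forall x, m <= vmu G x).
Hypotheses (D_uniq : uniq D) (U_sub : forall x, U x -> x \in D).
Hypothesis U_nbh : forall x y, U x -> adj G x y -> y \in D.
Hypothesis u_sol : is_mixed_solution G p q U u0 u.
Hypothesis u0_l1 : forall E : seq V, uniq E ->
  \sum_(x <- E) `|u0 x| * vmu G x <= S.

Let vmu_gt0 x : 0 < vmu G x. Proof. exact: lt_le_trans (vmu_gem x). Qed.

(** The functional with zero cutoff, for which the remainder vanishes. *)
Lemma entropy_decreasing s t : 0 < s -> s < q -> 0 < t ->
  \sum_(x <- D) `|u x t| `^ (1 + s) * vmu G x <=
  \sum_(x <- D) `|u x 0| `^ (1 + s) * vmu G x.
Proof.
move=> s0 sq t0; have s10 : 0 < 1 + s by rewrite addr_gt0.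
have := @functional_growth _ _ G p q s 1 U D u0 u (fun=> 0) p_gt1 s0 sq ltr01
  vmu_gt0 D_uniq U_nbh u_sol (fun _ _ => erefl) t 0 t0.
have E r : \sum_(x <- D) (0 * u x r + 1 * entropy s (u x r)) * vmu G x =
    (1 + s)^-1 * \sum_(x <- D) `|u x r| `^ (1 + s) * vmu G x.
  rewrite mulr_sumr; apply: eq_bigr => x _.
  by rewrite mul0r add0r mul1r /entropy; ring.
rewrite !E mulr0 addr0 ler_pM2l ?invr_gt0//; apply => r _ _.
rewrite big1 ?mulr0// => x _; rewrite big1// => y _.
by rewrite subrr normr0 powR0 ?mulr0 ?mul0r// gt_eqF// (lt_trans _ p_gt1).
Qed.

(** The absolute value is not differentiable at [0]; it is reached as the limit
    of the powers [1 + s] as [s] decreases to [0]. *)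
Lemma mixed_l1_contraction t : 0 < t ->
  \sum_(x <- D) `|u x t| * vmu G x <= \sum_(x <- D) `|u x 0| * vmu G x.
Proof.
move=> t0.
have C r : \sum_(x <- D) `|u x r| `^ (1 + s) * vmu G x @[s --> 0^'+] -->
    \sum_(x <- D) `|u x r| * vmu G x.
  by apply: cvg_sum_seq => x; apply: cvgMl; exact: powR_exponent_cvg.
apply: ler_cvg_to (C t) (C 0) _.
near=> s; apply: entropy_decreasing => //.
Unshelve. all: by end_near.
Qed.

Lemma mixed_init_le x : `|u x 0| <= `|u0 x|.
Proof.
have [_ _ init off] := u_sol.
by have [/init ->//|/off ->//] := pselect (U x); rewrite normr0.
Qed.

Lemma mixed_l1_le t : 0 <= t -> \sum_(x <- D) `|u x t| * vmu G x <= S.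
Proof.
have H0 : \sum_(x <- D) `|u x 0| * vmu G x <= S.
  apply: le_trans (u0_l1 D_uniq); apply: ler_sum => x _.
  by rewrite ler_wpM2r ?(ltW (vmu_gt0 x)) ?mixed_init_le.
rewrite le_eqVlt => /predU1P[<-//|t0].
exact: le_trans (mixed_l1_contraction t0) H0.
Qed.

(** A single vertex already carries mass at least [m]. *)
Lemma mixed_bounded x t : 0 <= t -> `|u x t| <= S / m.
Proof.
move=> t0; rewrite ler_pdivlMr//; have [xD|xD] := boolP (x \in D).
  apply: le_trans (mixed_l1_le t0).
  rewrite (big_rem x)//= -[leLHS]addr0 lerD ?ler_wpM2l//.
  by apply: sumr_ge0 => y _; rewrite mulr_ge0// ltW.
have [_ _ _ off] := u_sol; rewrite off//; last by move/U_sub; exact/negP.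
rewrite normr0 mul0r; apply: le_trans (mixed_l1_le (lexx 0)).
by apply: sumr_ge0 => y _; rewrite mulr_ge0// ltW.
Qed.

(** The bound does not involve [s], so it survives when [s] tends to [0]. *)
Lemma mixed_init_entropy_le s M : 0 < s -> s <= 1 -> 1 <= M -> S / m <= M ->
  \sum_(x <- D) entropy s (u x 0) * vmu G x <= M * S.
Proof.
move=> s0 s1 M1 SM.
have M0 : 0 <= M by exact: le_trans M1.
apply: (@le_trans _ _ (\sum_(x <- D) M * (`|u x 0| * vmu G x))); last first.
  by rewrite -mulr_sumr ler_wpM2l ?mixed_l1_le.
apply: ler_sum => x _; rewrite mulrA ler_wpM2r ?(ltW (vmu_gt0 x))//.
have s10 : 0 < 1 + s by rewrite addr_gt0.
have -> : entropy s (u x 0) = `|u x 0| `^ s / (1 + s) * `|u x 0|.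
  rewrite /entropy -[`|_| `^ (1 + s)]mulr_powRB1// (_ : 1 + s - 1 = s); last by ring.
  by ring.
rewrite ler_wpM2r// ler_pdivrMr//.
apply: (@le_trans _ _ (M `^ s)).
  by rewrite ge0_ler_powR ?nnegrE ?(ltW s0)// (le_trans (mixed_bounded _ _)).
apply: (le_trans (ler1_powR M1 s1)).
by rewrite ler_peMr// lerDl ltW.
Qed.
End L1.

(** * The logarithmic cutoff *)

Section PowerEstimates.
Variable R : realType.
Implicit Types a b r d p q s alpha beta kappa lam M h : R.

(** Interpolation of [a `^ beta] between [a] and [1], split at the threshold
    [h]. *)
Lemma powR_split_le a h beta : 0 <= beta -> beta <= 1 -> 0 <= a -> 0 < h ->
  a `^ beta <= a * h `^ (beta - 1) + h `^ beta.
Proof.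
move=> b0 b1 a0 h0.
have [ha|ah] := leP a h.
  apply: (@le_trans _ _ (h `^ beta)).
    by rewrite ge0_ler_powR// nnegrE ltW.
  by rewrite lerDr mulr_ge0 ?powR_ge0.
apply: (@le_trans _ _ (a * h `^ (beta - 1))); last by rewrite lerDl powR_ge0.
have a0' := lt_trans h0 ah.
have -> : a `^ beta = a * a `^ (beta - 1).
  rewrite -[X in _ = X * _]powRr1// -powRD ?subrKC//.
  by rewrite (gt_eqF a0') implybT.
rewrite ler_wpM2l// -opprB !powRN lef_pV2 ?posrE ?powR_gt0//.
by rewrite ge0_ler_powR ?nnegrE ?subr_ge0 ?(ltW h0) ?(ltW ah).
Qed.

Lemma powR_le_expR r N e : 1 <= r -> 0 <= e -> r <= expR N -> r `^ e <= expR (N * e).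
Proof.
move=> r1 e0 rN; rewrite expRM ge0_ler_powR ?nnegrE ?expR_ge0//.
exact: le_trans r1.
Qed.

(** [r] stands for one plus the distance to the origin, and [T] for the error
    due to a positive entropy exponent. Splitting at [h = kappa * r `^ (- d)]
    balances the two terms: the dimension condition makes the factor
    [h `^ (beta - 1) * r `^ (- p)] of [a], which will be summable, at most
    [kappa^-1 * r `^ T], and leaves the weight [r `^ (- d)], whose sum grows
    only logarithmically, with the small factor [kappa `^ (alpha / 2)]. The
    power [r `^ T] stays bounded as long as [N * T] does. *)
Lemma weight_le a r d p alpha beta kappa N T : 0 < d ->
  alpha / 2 <= beta -> 0 < alpha -> beta <= 1 -> 0 <= T ->
  d * (1 - beta) <= p + T -> 0 < kappa -> kappa <= 1 ->
  0 <= a -> 1 <= r -> r <= expR N ->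
  a `^ beta * r `^ (- p) <=
  expR (N * T) * (kappa^-1 * a + kappa `^ (alpha / 2) * r `^ (- d)).
Proof.
move=> d0 ab al0 b1 T0 dbT k0 k1 a0 r1 rN.
have b0 : 0 <= beta by apply: le_trans ab; rewrite divr_ge0 ?(ltW al0).
have r0 : 0 < r by exact: lt_le_trans r1.
have rn0 : r != 0 by rewrite gt_eqF.
pose h := kappa * r `^ (- d).
have h0 : 0 < h by rewrite mulr_gt0 ?powR_gt0.
have hE e : h `^ e = kappa `^ e * r `^ (- d * e).
  by rewrite powRM ?powR_ge0 ?(ltW k0)// powRrM.
have re : r `^ (d * (1 - beta) - p) <= expR (N * T).
  apply: le_trans (powR_le_expR r1 T0 rN).
  by apply: ler_powR => //; rewrite lerBlDl.
apply: (@le_trans _ _ ((a * h `^ (beta - 1) + h `^ beta) * r `^ (- p))).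
  by rewrite ler_wpM2r ?powR_ge0 ?powR_split_le.
rewrite mulrDl mulrDr lerD//.
  rewrite hE -!mulrA -powRD ?rn0 ?implybT//.
  have -> : - d * (beta - 1) + - p = d * (1 - beta) - p by ring.
  have -> : expR (N * T) * (kappa^-1 * a) = a * (kappa^-1 * expR (N * T)).
    by ring.
  apply: ler_wpM2l => //; apply: ler_pM; rewrite ?powR_ge0//.
  rewrite -powR_inv1 ?(ltW k0)//; apply: ger_powR; first by rewrite k0.
  by rewrite lerBrDr addrC subrr.
rewrite hE -mulrA -powRD ?rn0 ?implybT//.
have -> : - d * beta + - p = (d * (1 - beta) - p) + - d by ring.
rewrite powRD ?rn0 ?implybT// !mulrA ler_wpM2r ?powR_ge0// mulrC.
apply: ler_pM; rewrite ?powR_ge0//.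
by apply: ger_powR; rewrite ?k0.
Qed.

Lemma max_powR_le a b e M alpha beta : 0 <= a -> a <= M -> 0 <= b -> b <= M ->
  0 <= beta -> 0 < e -> e - beta = alpha -> 0 <= alpha ->
  Num.max a b `^ e <= M `^ alpha * (a `^ beta + b `^ beta).
Proof.
move=> a0 aM b0 bM be0 e0 eE al0.
have M0 := le_trans a0 aM.
have H c : 0 <= c -> c <= M -> c `^ e <= M `^ alpha * c `^ beta.
  move=> c0 cM; have -> : c `^ e = c `^ alpha * c `^ beta.
    by rewrite -eE -powRD ?subrK// gt_eqF.
  by rewrite ler_wpM2r ?powR_ge0// ge0_ler_powR ?nnegrE.
rewrite /Num.max; case: ifP => _; rewrite mulrDr.
  by apply: le_trans (H _ b0 bM) _; rewrite lerDr mulr_ge0 ?powR_ge0.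
by apply: le_trans (H _ a0 aM) _; rewrite lerDl mulr_ge0 ?powR_ge0.
Qed.

End PowerEstimates.

Section LogCutoff.
Variables (R : realType) (V : countType) (G : weighted_graph R V).
Variable rho : V -> nat.
Hypothesis rho_lip : forall x y, adj G x y -> (rho y <= (rho x).+1)%N.

Let r x : R := 1 + (rho x)%:R.

(** A cutoff that is linear in the logarithm of the distance, from [1] at the
    origin to [0] at distance [expR L]. Compared with a cutoff linear in the
    distance it gains a power of [L], which is what the equality case of the
    condition on the exponents requires. *)
Definition log_cutoff (L : nat) (x : V) : R :=
  Num.max 0 (1 - ln (1 + (rho x)%:R) / L%:R).

Variable L : nat.
Hypothesis L_gt0 : (0 < L)%N.

Let L0 : 0 < L%:R :> R. Proof. by rewrite ltr0n. Qed.
Let r1 x : 1 <= r x. Proof. by rewrite lerDl. Qed.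
Let r0 x : 0 < r x. Proof. exact: lt_le_trans (r1 x). Qed.

Lemma log_cutoff_ge0 x : 0 <= log_cutoff L x.
Proof. by rewrite /log_cutoff le_max lexx. Qed.

Lemma log_cutoff_le1 x : log_cutoff L x <= 1.
Proof.
rewrite /log_cutoff ge_max; apply/andP; split; first exact: ler01.
by rewrite gerBl divr_ge0 ?(ltW L0)// ln_ge0// r1.
Qed.

Lemma log_cutoff_eq0 x : expR L%:R <= r x -> log_cutoff L x = 0.
Proof.
move=> h; rewrite /log_cutoff max_l// subr_le0 ler_pdivlMr// mul1r.
by rewrite -ler_expR lnK// posrE; exact: r0.
Qed.

Let r_lip x y : adj G x y -> r y <= r x + 1.
Proof. by move=> /rho_lip h; rewrite /r -addrA natr1 lerD2l ler_nat. Qed.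

Lemma ln_diff_le (a b : R) : 0 < a -> 0 < b -> ln b - ln a <= (b - a) / a.
Proof.
move=> a0 b0; rewrite -ln_div ?posrE//.
have -> : b / a = 1 + (b - a) / a.
  by rewrite mulrBl divff ?gt_eqF// subrKC.
apply: le_ln1Dx.
by rewrite mulrBl divff ?gt_eqF// ltrBrDr addNr divr_gt0.
Qed.

Let ln_lip x y : adj G x y -> `|ln (r y) - ln (r x)| <= 2 / r x.
Proof.
move=> xy; have yx : adj G y x by rewrite adj_sym.
rewrite ler_norml; apply/andP; split.
  rewrite lerNl opprB; apply: le_trans (ln_diff_le (r0 y) (r0 x)) _.
  rewrite ler_pdivrMr ?r0// mulrAC ler_pdivlMr ?r0//.
  have := r_lip yx; have := r1 x; have := r1 y.
  have := r_lip xy; nra.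
apply: le_trans (ln_diff_le (r0 x) (r0 y)) _.
rewrite ler_pM2r ?invr_gt0 ?r0//; have := r_lip xy; lra.
Qed.

Lemma log_cutoff_diff x y : adj G x y ->
  `|log_cutoff L y - log_cutoff L x| <= 2 / L%:R / r x.
Proof.
move=> xy.
have max0_lip (a b : R) : `|Num.max 0 a - Num.max 0 b| <= `|a - b|.
  have [ha|ha] := leP 0 a; have [hb|hb] := leP 0 b => //.
  - by rewrite subr0 !ger0_norm; lra.
  - by rewrite sub0r normrN [X in X <= _]ger0_norm// ler0_norm; lra.
  - by rewrite subrr normr0.
apply: le_trans (max0_lip _ _) _.
have -> : (1 - ln (1 + (rho y)%:R) / L%:R) - (1 - ln (1 + (rho x)%:R) / L%:R) =
  (ln (r x) - ln (r y)) / L%:R :> R by rewrite /r; ring.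
rewrite normrM distrC normfV [`|L%:R|]gtr0_norm// mulrAC.
by rewrite ler_pM2r ?invr_gt0// ln_lip.
Qed.

(** The exponent is [L + 1] because the edge has to keep both of its ends out
    of the ball of radius [expR L]. *)
Lemma log_cutoff_diff0 x y : adj G x y -> expR (L%:R + 1) <= r x ->
  log_cutoff L y - log_cutoff L x = 0.
Proof.
move=> xy h; have yx : adj G y x by rewrite adj_sym.
have e2 : 2 <= expR 1 :> R by have := expR_ge1Dx (1 : R); lra.
have eL : 1 <= expR L%:R :> R by have := expR_ge1Dx (L%:R : R); have := L0; lra.
have h' := r_lip yx; move: (h); rewrite expRD => h''.
have h2 : expR L%:R * 2 <= expR L%:R * expR 1 :> R.
  by rewrite ler_wpM2l ?expR_ge0.
by rewrite !log_cutoff_eq0 ?subrr//; lra.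
Qed.

End LogCutoff.

(** * The remainder of the cutoff *)

Section Remainder.
Variables (R : realType) (V : countType) (G : weighted_graph R V).
Variable rho : V -> nat.
Hypothesis rho_lip : forall x y, adj G x y -> (rho y <= (rho x).+1)%N.
Variables (C d : R).
Hypotheses (C_gt0 : 0 < C) (d_gt0 : 0 < d).
Hypothesis volume : forall (E : seq V) (t : R), uniq E -> 0 <= t ->
  (forall x, x \in E -> (rho x)%:R <= t) ->
  \sum_(x <- E) vmu G x <= C * (1 + t) `^ d.

Let r x : R := 1 + (rho x)%:R.
Let r1 x : 1 <= r x. Proof. by rewrite lerDl. Qed.
Let r0 x : 0 < r x. Proof. exact: lt_le_trans (r1 x). Qed.

Let volume_r (E : seq V) (t : R) : uniq E -> 1 <= t ->
  \sum_(x <- E | r x <= t) vmu G x <= C * t `^ d.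
Proof.
move=> uE t1; rewrite -big_filter -[t in t `^ d](subrKC 1).
apply: volume => [||x]; rewrite ?filter_uniq ?subr_ge0//.
by rewrite mem_filter => /andP[+ _]; rewrite /r lerBrDl.
Qed.

(** Each annulus between radii [expR k] and [expR (k + 1)] contributes at most
    [C * expR d], by volume growth. *)
Lemma weighted_volume_le (E : seq V) (n : nat) : uniq E ->
  \sum_(x <- E | r x <= expR n%:R) r x `^ (- d) * vmu G x <=
  C * expR d * (n%:R + 1).
Proof.
move=> uE; elim: n => [|n IH].
  rewrite expR0 add0r mulr1.
  apply: (@le_trans _ _ (\sum_(x <- E | r x <= 1) vmu G x)).
    apply: ler_sum => x x1; have -> : r x = 1 by apply/eqP; rewrite eq_le x1 r1.
    by rewrite powR1 mul1r.
  apply: (le_trans (volume_r uE (lexx 1))); rewrite powR1 ler_pM2l//.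
  by have := expR_ge1Dx d; have := d_gt0; lra.
rewrite (bigID (fun x => r x <= expR n%:R))/=.
rewrite -[n.+1%:R]natr1 mulrDr mulr1 lerD//.
  rewrite (eq_bigl (fun x => r x <= expR n%:R))// => x.
  rewrite andb_idl// => /le_trans; apply.
  by rewrite ler_expR lerDl.
apply: (@le_trans _ _ (\sum_(x <- E | r x <= expR (n%:R + 1))
    (expR n%:R `^ d)^-1 * vmu G x)).
  rewrite [leRHS](bigID (fun x => r x <= expR n%:R))/=.
  apply: ler_wpDl.
    by apply: sumr_ge0 => x _; rewrite mulr_ge0 ?vmu_ge0// invr_ge0 powR_ge0.
  rewrite natr1; apply: ler_sum => x /andP[_]; rewrite -ltNge => h.
  rewrite ler_wpM2r ?vmu_ge0// powRN lef_pV2 ?posrE ?powR_gt0 ?expR_gt0//.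
  by rewrite ge0_ler_powR ?nnegrE ?expR_ge0 ?(ltW d_gt0) ?(ltW h) ?(ltW (r0 x)).
rewrite -mulr_sumr.
have e1 : 1 <= expR (n%:R + 1) :> R.
  by have := expR_ge1Dx (n%:R + 1 : R); have := ler0n R n; lra.
apply: le_trans (ler_wpM2l _ (volume_r uE e1)) _.
  by rewrite invr_ge0 powR_ge0.
rewrite -!expRM mulrDl mul1r expRD mulrCA [X in _ * X <= _]mulrA mulVf ?mul1r//.
by rewrite gt_eqF ?expR_gt0.
Qed.

Variables (p q alpha M S : R) (D : seq V).
Hypotheses (p_gt1 : 1 < p) (q_gt0 : 0 < q) (D_uniq : uniq D).
Hypotheses (alpha_gt0 : 0 < alpha) (alpha_lt1 : alpha < 1).
Hypotheses (alpha_le : alpha <= q * (p - 1)) (alpha_dim : d * (1 - alpha) <= p).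

Lemma sum_sym_le (w : V -> R) (g : V -> R) (H : V -> V -> R) :
  (forall x y, H x y = H y x) -> (forall x, 0 <= w x) ->
  (forall x, \sum_(y <- D) H x y <= g x) ->
  2^-1 * \sum_(x <- D) \sum_(y <- D) (w x + w y) * H x y <=
  \sum_(x <- D) w x * g x.
Proof.
move=> Hs w0 Hg.
have -> : \sum_(x <- D) \sum_(y <- D) (w x + w y) * H x y =
    \sum_(x <- D) w x * \sum_(y <- D) H x y +
    \sum_(x <- D) w x * \sum_(y <- D) H x y.
  rewrite [X in _ = X + _](_ : _ = \sum_(x <- D) \sum_(y <- D) w x * H x y);
    last by apply: eq_bigr => x _; rewrite mulr_sumr.
  rewrite [X in _ = _ + X](_ : _ = \sum_(x <- D) \sum_(y <- D) w y * H x y).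
    rewrite -big_split/=; apply: eq_bigr => x _.
    by rewrite -big_split/=; apply: eq_bigr => y _; rewrite mulrDl.
  rewrite exchange_big/=; apply: eq_bigr => x _.
  by rewrite mulr_sumr; apply: eq_bigr => y _; rewrite Hs.
apply: (@le_trans _ _ (\sum_(x <- D) w x * \sum_(y <- D) H x y)); first lra.
by apply: ler_sum => x _; rewrite ler_wpM2l.
Qed.

Definition remainder_const :=
  q `^ (p - 1) * 2 `^ p * M `^ (q * (p - 1) - alpha) * expR (2 * (d * (p - 1))).

(** The entropy exponent [s = 1 / L] is tied to the scale of the cutoff. The
    factor [(q / s) `^ (p - 1)], of order [L `^ (p - 1)], is compensated by
    the factor [L `^ (- p)] from the gradient of the cutoff; one power of [L] is
    left over. It beats the first term, and in the second it cancels the number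
    of annuli, of order [L], counted by [weighted_volume_le]. The second term is
    thus not small as [L] grows, but it carries a positive power of [kappa]. *)
Lemma remainder_le (L : nat) (kappa lam : R) (v : V -> R) (s := L%:R^-1 : R) :
  (0 < L)%N -> s < q -> (p - 1) * s <= alpha / 2 ->
  0 < kappa -> kappa <= 1 -> 0 < lam ->
  (forall x, `|v x| <= M) -> \sum_(x <- D) `|v x| * vmu G x <= S ->
  2^-1 * \sum_(x <- D) \sum_(y <- D)
     (q / s * Num.max `|v x| `|v y| `^ (q - s) / lam) `^ (p - 1) *
     `|log_cutoff R rho L y - log_cutoff R rho L x| `^ p * G x y <=
  remainder_const * lam `^ (- (p - 1)) *
    (kappa^-1 * S / L%:R + 3 * kappa `^ (alpha / 2) * (C * expR d)).
Proof.
move=> L0 sq ps k0 k1 lam0 vM vS.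
have LR0 : 0 < L%:R :> R by rewrite ltr0n.
have L1 : 1 <= L%:R :> R by rewrite ler1n.
have s0 : 0 < s by rewrite invr_gt0.
have p10 : 0 < p - 1 by rewrite subr_gt0.
have p0 : 0 < p by exact: lt_trans p_gt1.
set eta := log_cutoff R rho L.
(* The exponent of the interpolation, after the loss due to [s]. *)
pose beta := alpha - (p - 1) * s.
have be_ge : alpha / 2 <= beta by rewrite /beta; lra.
have be0 : 0 <= beta by apply: le_trans be_ge; rewrite divr_ge0// ltW.
have be1 : beta <= 1.
  by have := mulr_gt0 p10 s0; have := alpha_lt1; rewrite /beta; lra.
pose A := (q * L%:R / lam) `^ (p - 1) * M `^ (q * (p - 1) - alpha).
have A0 : 0 <= A by rewrite mulr_ge0 ?powR_ge0.
(* Bounds the [p]-th power of the slope of the cutoff on every edge at [x]. *)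
pose g x : R := if r x <= expR (L%:R + 1) then (2 / L%:R / r x) `^ p else 0.
apply: (@le_trans _ _ (A * \sum_(x <- D) `|v x| `^ beta * (g x * vmu G x))).
  apply: (@le_trans _ _ (A * (2^-1 * \sum_(x <- D) \sum_(y <- D)
      (`|v x| `^ beta + `|v y| `^ beta) * (`|eta y - eta x| `^ p * G x y)))).
    rewrite mulrCA ler_wpM2l ?invr_ge0// mulr_sumr; apply: ler_sum => x _.
    rewrite mulr_sumr; apply: ler_sum => y _.
    rewrite -[leLHS]mulrA [leRHS]mulrA ler_wpM2r ?mulr_ge0 ?powR_ge0 ?wgt_ge0//.
    rewrite /s invrK mulrAC powRM ?powR_ge0 ?divr_ge0 ?mulr_ge0
      ?(ltW q_gt0) ?(ltW LR0) ?(ltW lam0)//.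
    rewrite /A -[leRHS]mulrA ler_wpM2l ?powR_ge0// -powRrM.
    apply: max_powR_le => //.
    - by rewrite mulr_gt0// subr_gt0.
    - by rewrite /beta /s; ring.
    - by rewrite subr_ge0.
  rewrite ler_wpM2l//; apply: sum_sym_le => [x y|x|x].
  - by rewrite wgt_sym distrC.
  - exact: powR_ge0.
  rewrite /g; have [rx|rx] := leP (r x) (expR (L%:R + 1)).
    apply: (@le_trans _ _ (\sum_(y <- D) (2 / L%:R / r x) `^ p * G x y)).
      apply: ler_sum => y _; have [xy|/negP xy] := boolP (adj G x y).
        rewrite ler_wpM2r ?wgt_ge0// ge0_ler_powR ?nnegrE ?(ltW p0)//.
          by rewrite !divr_ge0// (ltW (r0 x)).
        exact: (log_cutoff_diff rho_lip L0 xy).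
      by rewrite (wgt_adj0 xy) !mulr0.
    by rewrite -mulr_sumr ler_wpM2l ?powR_ge0// sum_wgt_le.
  rewrite mul0r big1// => y _; have [xy|/negP xy] := boolP (adj G x y).
    rewrite (log_cutoff_diff0 rho_lip L0 xy) ?(ltW rx)//.
    by rewrite normr0 powR0 ?mul0r// gt_eqF.
  by rewrite (wgt_adj0 xy) mulr0.
have N1 : (L%:R + 1) * (d * (p - 1) * s) <= 2 * (d * (p - 1)).
  rewrite mulrCA mulrC ler_wpM2r ?mulr_ge0 ?(ltW d_gt0) ?(ltW p10)//.
  by rewrite /s mulrDl divff ?gt_eqF// mul1r -[2]/(1 + 1) lerD2l invf_le1.
pose B := (2 / L%:R) `^ p * expR (2 * (d * (p - 1))).
have B0 : 0 <= B by rewrite mulr_ge0 ?powR_ge0 ?expR_ge0.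
have term x : `|v x| `^ beta * (g x * vmu G x) <=
    B * (kappa^-1 * (`|v x| * vmu G x)) +
    B * (kappa `^ (alpha / 2) *
      (if r x <= expR L.+1%:R then r x `^ (- d) * vmu G x else 0)).
  rewrite /g -[L.+1%:R]natr1; case: ifPn => [rx|_]; last first.
    by rewrite mul0r !mulr0 addr0 !mulr_ge0 ?vmu_ge0// invr_ge0 ltW.
  have T0 : 0 <= d * (p - 1) * s.
    by rewrite !mulr_ge0 ?(ltW d_gt0) ?(ltW p10) ?(ltW s0).
  have dT : d * (1 - beta) <= p + d * (p - 1) * s.
    by move: alpha_dim; rewrite /beta; lra.
  have := weight_le d_gt0 be_ge alpha_gt0 be1 T0 dT k0 k1 (normr_ge0 (v x)) (r1 x) rx.
  set W := kappa^-1 * _ + _ => h.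
  have {}h : `|v x| `^ beta * r x `^ (- p) <= expR (2 * (d * (p - 1))) * W.
    apply: (le_trans h); rewrite ler_wpM2r ?ler_expR//.
    by rewrite addr_ge0 ?mulr_ge0 ?powR_ge0 ?invr_ge0 ?(ltW k0).
  have -> : (2 / L%:R / r x) `^ p = (2 / L%:R) `^ p * r x `^ (- p).
    rewrite powRM ?divr_ge0 ?invr_ge0 ?(ltW LR0) ?(ltW (r0 x))//.
    by rewrite -[(r x)^-1]powR_inv1 ?(ltW (r0 x))// -powRrM mulN1r.
  apply: (@le_trans _ _ ((2 / L%:R) `^ p * (expR (2 * (d * (p - 1))) * W) * vmu G x)).
    rewrite mulrA ler_wpM2r ?vmu_ge0// mulrCA ler_wpM2l ?powR_ge0//.
  by rewrite le_eqVlt; apply/orP; left; apply/eqP; rewrite /B /W; ring.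
apply: (@le_trans _ _ (A * (B * (kappa^-1 * S) +
    B * (kappa `^ (alpha / 2) * (C * expR d * (L.+1%:R + 1)))))).
  rewrite ler_wpM2l//; apply: (le_trans (ler_sum _ (fun x _ => term x))).
  rewrite big_split/= -!mulr_sumr lerD// ler_wpM2l//.
    by rewrite ler_wpM2l ?invr_ge0// ltW.
  by rewrite ler_wpM2l ?powR_ge0// -big_mkcond/= weighted_volume_le.
have -> : A * (B * (kappa^-1 * S) +
    B * (kappa `^ (alpha / 2) * (C * expR d * (L.+1%:R + 1)))) =
  remainder_const * lam `^ (- (p - 1)) * (kappa^-1 * S / L%:R +
    (L.+1%:R + 1) / L%:R * kappa `^ (alpha / 2) * (C * expR d)).
  have e : A * B = remainder_const * lam `^ (- (p - 1)) / L%:R.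
    rewrite /A /B /remainder_const.
    rewrite !powRM ?powR_ge0 ?invr_ge0 ?mulr_ge0 ?(ltW q_gt0) ?(ltW LR0) ?(ltW lam0)//.
    have -> : L%:R^-1 `^ p = L%:R^-1 * L%:R `^ (- (p - 1)) :> R.
      rewrite -powR_inv1 ?(ltW LR0)// -powRrM -powRD ?(gt_eqF LR0) ?implybT//.
      by congr (_ `^ _); ring.
    rewrite -[lam^-1]powR_inv1 ?(ltW lam0)// -powRrM mulN1r.
    rewrite [L%:R `^ (- _)]powRN.
    have : L%:R `^ (p - 1) != 0 :> R by rewrite gt_eqF// powR_gt0.
    move: (L%:R `^ (p - 1)) => z z0; field.
    by rewrite z0 gt_eqF.
  by rewrite -mulrDr mulrA e; ring.
rewrite ler_wpM2l//; first by rewrite !mulr_ge0 ?powR_ge0 ?expR_ge0.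
rewrite lerD2l -[leLHS]mulrA -[leRHS]mulrA ler_wpM2r ?mulr_ge0
  ?powR_ge0 ?expR_ge0 ?(ltW C_gt0)//.
by rewrite ler_pdivrMr// -[L.+1%:R]natr1; lra.
Qed.

End Remainder.

(** * Signed sums as limits of cutoff sums *)

Lemma eq_sum_support (R : nmodType) (T : choiceType) (D E : seq T) (f : T -> R) :
  uniq D -> uniq E -> (forall x, x \notin D -> f x = 0) ->
  (forall x, x \notin E -> f x = 0) ->
  \sum_(x <- D) f x = \sum_(x <- E) f x.
Proof.
have H (B : seq T) : uniq B -> (forall x, x \notin B -> f x = 0) ->
    \sum_(x <- B) f x = \sum_(x \in [set: T]) f x.
  move=> uB fB; rewrite (fsbigE B)//=; last by move=> x _ /fB.
  by apply: eq_bigl => x; rewrite in_setT.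
by move=> uD uE fD fE; rewrite (H D)// (H E).
Qed.

Section CutoffLimit.
Variables (R : realType) (V : countType) (G : weighted_graph R V).
Variable rho : V -> nat.
Local Notation eta L := (log_cutoff R rho L).

(** Monotone convergence: the cutoffs take values in [0, 1] and increase to [1]
    at every vertex. *)
Lemma nneg_cutoff_limit (g : V -> R) (S : R) : (forall x, 0 <= g x) ->
  (forall E, uniq E -> \sum_(x <- E) g x <= S) ->
  exists2 F : R, \esum_(x in [set: V]) (g x)%:E = F%:E &
    forall e, 0 < e -> exists L0, forall L E, (L0 < L)%N -> uniq E ->
      (forall x, x \notin E -> eta L x = 0) ->
      `|\sum_(x <- E) eta L x * g x - F| <= e.
Proof.
move=> g0 gS.
have ge0 : (0 <= \esum_(x in [set: V]) (g x)%:E)%E.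
  by apply: esum_ge0 => x _; rewrite lee_fin.
have leS : (\esum_(x in [set: V]) (g x)%:E <= S%:E)%E.
  apply: ge_ereal_sup => _ [X [finX _] <-].
  rewrite fsbig_finite//= sumEFin lee_fin; apply: gS.
  exact: finmap.fset_uniq.
have fin : \esum_(x in [set: V]) (g x)%:E \is a fin_num.
  by rewrite ge0_fin_numE//; apply: le_lt_trans leS (ltry _).
exists (fine (\esum_(x in [set: V]) (g x)%:E)); first by rewrite fineK.
set F := fine _ => e e0.
have FE : \esum_(x in [set: V]) (g x)%:E = F%:E by rewrite fineK.
have up E : uniq E -> \sum_(x <- E) g x <= F.
  by move=> uE; rewrite -lee_fin -FE fsets_sum_le_esum.
have [X [uX hX]] : exists X : seq V, uniq X /\ F - e / 2 < \sum_(x <- X) g x.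
  have : ((F - e / 2)%:E < \esum_(x in [set: V]) (g x)%:E)%E.
    by rewrite FE lte_fin; lra.
  move=> /ereal_sup_gt[_ [X [finX _] <-]].
  rewrite fsbig_finite//= sumEFin lte_fin => h.
  by exists (finmap.enum_fset (fset_set X)); split => //; exact: finmap.fset_uniq.
(* Since [1 - eta L x <= ln (1 + rho x) / L], replacing [eta L] by [1] on [X]
   costs at most [Y / L]. *)
pose Y := \sum_(x <- X) g x * ln (1 + (rho x)%:R).
exists (Num.truncn (2 * Y / e)) => L E L0L uE offE.
have L0 : (0 < L)%N by exact: leq_ltn_trans L0L.
have LR0 : 0 < L%:R :> R by rewrite ltr0n.
have YL : Y / L%:R <= e / 2.
  have : 2 * Y / e < L%:R.
    by apply: lt_le_trans (truncnS_gt _) _; rewrite ler_nat.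
  by rewrite ltr_pdivrMr// ler_pdivrMr// => h; lra.
have hi : \sum_(x <- E) eta L x * g x <= F.
  apply: le_trans (up E uE); apply: ler_sum => x _.
  by rewrite ler_piMl// log_cutoff_le1.
have lo : F - e <= \sum_(x <- E) eta L x * g x.
  have -> : \sum_(x <- E) eta L x * g x =
      \sum_(x <- undup (E ++ X)) eta L x * g x.
    apply: eq_sum_support; rewrite ?undup_uniq// => x.
      by move/offE => ->; rewrite mul0r.
    by rewrite mem_undup mem_cat negb_or => /andP[/offE -> _]; rewrite mul0r.
  apply: (@le_trans _ _ (\sum_(x <- X) eta L x * g x)); last first.
    apply: ler_sum_subset => // [x xX|x].
      by rewrite mem_undup mem_cat xX orbT.
    by rewrite mulr_ge0// log_cutoff_ge0.
  apply: (@le_trans _ _ (\sum_(x <- X) g x - Y / L%:R)); first lra.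
  rewrite /Y mulr_suml -sumrB; apply: ler_sum => x _.
  have : 1 - ln (1 + (rho x)%:R) / L%:R <= eta L x.
    by rewrite /log_cutoff le_max lexx orbT.
  move/(ler_wpM2l (g0 x)); rewrite [eta L x * _]mulrC; apply: le_trans.
  by rewrite le_eqVlt; apply/orP; left; apply/eqP; ring.
by rewrite ler_norml; apply/andP; split; lra.
Qed.

Lemma vsum_cutoff_limit (f : V -> R) (S : R) :
  (forall E, uniq E -> \sum_(x <- E) `|f x| * vmu G x <= S) ->
  exists2 F : R, vsum G f = F%:E &
    forall e, 0 < e -> exists L0, forall L E, (L0 < L)%N -> uniq E ->
      (forall x, x \notin E -> eta L x = 0) ->
      `|\sum_(x <- E) eta L x * (f x * vmu G x) - F| <= e.
Proof.
move=> fS.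
pose gp x := Num.max (f x * vmu G x) 0.
pose gn x := Num.max (- (f x * vmu G x)) 0.
have gE x : f x * vmu G x = gp x - gn x.
  by rewrite /gp /gn; have [h|h] := leP (f x * vmu G x) 0;
    have [h'|h'] := leP (- (f x * vmu G x)) 0; lra.
have bnd (g : V -> R) : (forall x, g x <= `|f x| * vmu G x) ->
    forall E, uniq E -> \sum_(x <- E) g x <= S.
  by move=> gf E uE; apply: le_trans (fS E uE); apply: ler_sum.
have absE x : `|f x| * vmu G x = `|f x * vmu G x|.
  by rewrite normrM [X in _ = _ * X]ger0_norm ?vmu_ge0.
have gp_le x : gp x <= `|f x| * vmu G x.
  by rewrite absE /gp ge_max ler_norm normr_ge0.
have gn_le x : gn x <= `|f x| * vmu G x.
  by rewrite absE /gn ge_max -normrN ler_norm normr_ge0.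
have gp0 x : 0 <= gp x by rewrite /gp le_max lexx orbT.
have gn0 x : 0 <= gn x by rewrite /gn le_max lexx orbT.
have [P PE Plim] := nneg_cutoff_limit gp0 (bnd _ gp_le).
have [N NE Nlim] := nneg_cutoff_limit gn0 (bnd _ gn_le).
exists (P - N).
  rewrite /vsum EFinB -PE -NE; congr (_ - _)%E; apply: eq_esum => x _.
    by rewrite /gp funeposE EFin_max.
  by rewrite /gn funenegE EFin_max EFinN.
move=> e e0; have e20 : 0 < e / 2 by rewrite divr_gt0.
have [L1 h1] := Plim _ e20; have [L2 h2] := Nlim _ e20.
exists (maxn L1 L2) => L E; rewrite gtn_max => /andP[l1 l2] uE off.
have := h1 L E l1 uE off; have := h2 L E l2 uE off.
have -> : \sum_(x <- E) eta L x * (f x * vmu G x) =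
    \sum_(x <- E) eta L x * gp x - \sum_(x <- E) eta L x * gn x.
  by rewrite -sumrB; apply: eq_bigr => x _; rewrite gE mulrBr.
rewrite !ler_norml => /andP[? ?] /andP[? ?]; apply/andP; split; lra.
Qed.

End CutoffLimit.

(** * Conservation of mass *)

(** [alpha] takes the place of [a = q (p - 1)] when the latter is too large for
    the interpolation, which needs an exponent below [1]; lowering the exponent
    costs only a power of the uniform bound on the solutions. *)
Lemma critical_exponent (R : realType) (d p a : R) : 0 < d -> 0 < p -> 0 < a ->
  (d - p) / d <= a ->
  exists alpha, [/\ 0 < alpha, alpha < 1, alpha <= a & d * (1 - alpha) <= p].
Proof.
move=> d0 p0 a0; rewrite ler_pdivrMr// => cond.
have pd0 : 0 < p / d by rewrite divr_gt0.
have [a1|a1] := ltP a 1; first by exists a; split => //; nra.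
have pdE : d * (p / d) = p by rewrite mulrCA divff ?mulr1 ?gt_eqF.
have [h|h] := leP (p / d) (1 / 2).
  by exists (1 - p / d); split; rewrite ?opprB ?subrKC; lra.
by exists (1 / 2); split; try lra; nra.
Qed.

(** Fixes the order of the choices: [kappa] makes the second term small, and only
    then [L] is taken large enough to absorb [kappa^-1]. *)
Lemma exists_small_scale (R : realType) (Y Z b t e : R) :
  0 <= Y -> 0 <= Z -> 0 < b -> 0 <= t -> 0 < e ->
  exists kappa, [/\ 0 < kappa, kappa <= 1 &
    exists L0 : nat, forall L : nat, (L0 < L)%N ->
      t * (kappa^-1 * Y / L%:R + kappa `^ b * Z) <= e].
Proof.
move=> Y0 Z0 b0 t0 e0.
pose w := e / (2 * (t * Z + 1)).
have tZ0 : 0 <= t * Z by rewrite mulr_ge0.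
have w0 : 0 < w by rewrite divr_gt0// mulr_gt0//; lra.
pose kappa := Num.min 1 (w `^ b^-1).
have k0 : 0 < kappa by rewrite lt_min ltr01/= powR_gt0.
exists kappa; split=> //; first by rewrite ge_min lexx.
have kb : kappa `^ b <= w.
  have -> : w = (w `^ b^-1) `^ b by rewrite -powRrM mulVf ?gt_eqF// powRr1// ltW.
  by rewrite ge0_ler_powR ?nnegrE ?powR_ge0 ?(ltW b0) ?(ltW k0)// ge_min lexx orbT.
exists (Num.truncn (t * (kappa^-1 * Y) * 2 / e)) => L hL.
have L0 : 0 < L%:R :> R by rewrite ltr0n; exact: leq_ltn_trans hL.
have hY : t * (kappa^-1 * Y / L%:R) <= e / 2.
  have : t * (kappa^-1 * Y) * 2 / e < L%:R.
    by apply: lt_le_trans (truncnS_gt _) _; rewrite ler_nat.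
  by rewrite ltr_pdivrMr// => h; rewrite mulrA ler_pdivrMr//; lra.
have hZ : t * (kappa `^ b * Z) <= e / 2.
  apply: (@le_trans _ _ (w * (t * Z))).
    by rewrite mulrCA ler_wpM2r.
  rewrite /w mulrAC ler_pdivrMr; last by rewrite mulr_gt0//; lra.
  by have := mulr_ge0 (ltW e0) tZ0; lra.
by rewrite mulrDr; lra.
Qed.

Section Conservation.
Variables (R : realType) (V : countType) (G : weighted_graph R V).
Variables (x0 : V) (rho : V -> nat).
Hypothesis rho_lip : forall x y, adj G x y -> (rho y <= (rho x).+1)%N.
Hypothesis rho_ball : forall x r, gball G x0 r x <-> (rho x)%:R <= r.
Variables (C d p q S : R).
Hypotheses (C_gt0 : 0 < C) (d_gt0 : 0 < d) (p_gt1 : 1 < p) (q_gt0 : 0 < q).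
Hypothesis mu0_gt0 : 0 < inf (range (vmu G)).
Hypothesis volume_growth : forall r : R, 0 <= r ->
  (vmu_set G (gball G x0 r) <= (C * (1 + r) `^ d)%:E)%E.
Hypothesis pq_cond : (d - p) / d <= q * (p - 1).
Variable u0 : V -> R.
Hypothesis u0_l1 : forall E : seq V, uniq E ->
  \sum_(x <- E) `|u0 x| * vmu G x <= S.

Local Notation eta L := (log_cutoff R rho L).

Lemma volume_sum (E : seq V) (t : R) : uniq E -> 0 <= t ->
  (forall x, x \in E -> (rho x)%:R <= t) ->
  \sum_(x <- E) vmu G x <= C * (1 + t) `^ d.
Proof.
move=> uE t0 Et; rewrite -lee_fin; apply: le_trans (volume_growth t0).
apply: fsets_sum_le_esum (vmu_ge0 G) => // x xE.
by apply/rho_ball/Et.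
Qed.

Lemma ball_enum (r : R) : 0 <= r ->
  exists D : seq V, uniq D /\ forall x, x \in D <-> (rho x)%:R <= r.
Proof.
move=> r_ge0.
have fin := volume_finite mu0_gt0 (volume_growth r_ge0).
exists (finmap.enum_fset (fset_set (gball G x0 r))).
split=> [|x]; first exact: finmap.fset_uniq.
rewrite -rho_ball; split=> [h|h].
  by apply/set_mem; rewrite -in_fset_set.
by have : x \in gball G x0 r := mem_set h; rewrite -in_fset_set.
Qed.

Lemma ball_nbh_enum (N : nat) : exists D : seq V,
  [/\ uniq D, forall x, gball G x0 N%:R x -> x \in D &
      forall x y, gball G x0 N%:R x -> adj G x y -> y \in D].
Proof.
have [D [uD inD]] := @ball_enum (N%:R + 1) (addr_ge0 (ler0n R N) ler01).
exists D; split=> // [x|x y].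
  by move=> /rho_ball h; apply/inD; apply: le_trans h _; rewrite lerDl.
move=> /rho_ball; rewrite ler_nat => h /rho_lip h'; apply/inD.
by rewrite natr1 ler_nat (leq_trans h').
Qed.

Let S_ge0 : 0 <= S.
Proof. by have := u0_l1 (E := [::]) erefl; rewrite big_nil. Qed.

(* Bounds all the approximating solutions at all times; at least [1], so that
   its small powers are bounded by [M] itself. *)
Let M := Num.max 1 (S / inf (range (vmu G))).

(** The threshold [L0] depends neither on the ball nor on the solution, which is
    what allows the passage to the limit along the exhaustion. *)
Lemma mixed_mass_defect (t e : R) : 0 < t -> 0 < e ->
  exists L0 : nat, forall L N u E, (L0 < L)%N -> expR L%:R <= 1 + N%:R :> R ->
    is_mixed_solution G p q (gball G x0 N%:R) u0 u -> uniq E ->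
    (forall x, x \notin E -> eta L x = 0) ->
    `|\sum_(x <- E) eta L x * ((u x t - u0 x) * vmu G x)| <= e.
Proof.
move=> t0 e0.
have p0 : 0 < p by exact: lt_trans p_gt1.
have p10 : 0 < p - 1 by rewrite subr_gt0.
have [alpha [al0 al1 al_le al_dim]] :=
  critical_exponent d_gt0 p0 (mulr_gt0 q_gt0 p10) pq_cond.
have M1 : 1 <= M by rewrite le_max lexx.
have M0 : 0 <= M by exact: le_trans M1.
have SM : S / inf (range (vmu G)) <= M by rewrite le_max lexx orbT.
have vmu_gt0 x : 0 < vmu G x by exact: lt_le_trans (inf_vmu_le G x).
have MS0 : 0 <= M * S by rewrite mulr_ge0.
(* The weight of the entropy is chosen so that its initial value costs at most
   [e / 2]; the remainder gets the other half. *)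
pose lam := e / (2 * (M * S + 1)).
have lam0 : 0 < lam by rewrite divr_gt0// mulr_gt0//; lra.
have lamMS : lam * (M * S) <= e / 2.
  rewrite /lam mulrAC ler_pdivrMr; last by rewrite mulr_gt0//; lra.
  by have := mulr_ge0 (ltW e0) MS0; lra.
set K := remainder_const d p q alpha M * lam `^ (- (p - 1)).
have K0 : 0 <= K by rewrite !mulr_ge0 ?powR_ge0 ?expR_ge0.
have e20 : 0 < e / 2 by rewrite divr_gt0.
have al20 : 0 < alpha / 2 by rewrite divr_gt0.
have Z0 : 0 <= 3 * (C * expR d) by rewrite !mulr_ge0 ?expR_ge0 ?(ltW C_gt0).
have [kappa [k0 k1 [L1 HL]]] := exists_small_scale S_ge0 Z0 al20
  (mulr_ge0 (ltW t0) K0) e20.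
exists (maxn L1 (maxn (Num.truncn q^-1) (Num.truncn ((p - 1) / (alpha / 2))))).
move=> L N u E; rewrite !gtn_max => /and3P[L1L qL aL] LN sol uE offE.
have L0 : (0 < L)%N by exact: leq_ltn_trans L1L.
have LR0 : 0 < L%:R :> R by rewrite ltr0n.
have trunc_lt (z : R) : (Num.truncn z < L)%N -> z < L%:R.
  by move=> h; apply: lt_le_trans (truncnS_gt _) _; rewrite ler_nat.
pose s : R := L%:R^-1.
have s0 : 0 < s by rewrite invr_gt0.
have s1 : s <= 1 by rewrite invf_le1// ler1n.
have sq : s < q by rewrite invf_plt ?posrE//; exact: trunc_lt.
have ps : (p - 1) * s <= alpha / 2.
  rewrite ler_pdivrMr// mulrC -ler_pdivrMr//; apply: ltW; exact: trunc_lt.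
have [D [uD UD UnD]] := ball_nbh_enum N.
have offU x : ~ gball G x0 N%:R x -> eta L x = 0.
  rewrite rho_ball => /negP; rewrite -ltNge ltr_nat => h.
  apply: log_cutoff_eq0 => //; apply: le_trans LN _.
  by rewrite lerD2l ler_nat ltnW.
have uM x r : 0 <= r -> `|u x r| <= M.
  move=> r0; apply: le_trans SM.
  exact: (mixed_bounded p_gt1 q_gt0 mu0_gt0 (inf_vmu_le G) uD UD UnD sol u0_l1).
have uS r : 0 <= r -> \sum_(x <- D) `|u x r| * vmu G x <= S.
  exact: (mixed_l1_le p_gt1 q_gt0 mu0_gt0 (inf_vmu_le G) uD UnD sol u0_l1).
have ent0 : \sum_(x <- D) entropy s (u x 0) * vmu G x <= M * S.
  exact: (mixed_init_entropy_le p_gt1 q_gt0 mu0_gt0 (inf_vmu_le G) uD UD UnD sol u0_l1).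
have ent_ge0 : 0 <= \sum_(x <- D) entropy s (u x t) * vmu G x.
  by apply: sumr_ge0 => x _; rewrite mulr_ge0 ?entropy_ge0 ?vmu_ge0.
pose W := K * (kappa^-1 * S / L%:R + kappa `^ (alpha / 2) * (3 * (C * expR d))).
have tW : t * W <= e / 2 by rewrite mulrA; exact: HL.
have rem r : 0 < r -> 2^-1 * \sum_(x <- D) \sum_(y <- D)
     (q / s * Num.max `|u x r| `|u y r| `^ (q - s) / lam) `^ (p - 1) *
     `|eta L y - eta L x| `^ p * G x y <= W.
  move=> r0; apply: le_trans (remainder_le rho_lip C_gt0 d_gt0 volume_sum
    p_gt1 q_gt0 uD al0 al1 al_le al_dim L0 sq ps k0 k1 lam0
    (fun x => uM x r (ltW r0)) (uS r (ltW r0))) _.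
  rewrite /W (_ : 3 * kappa `^ (alpha / 2) * (C * expR d) =
    kappa `^ (alpha / 2) * (3 * (C * expR d)))//; ring.
pose F r := \sum_(x <- D) eta L x * (u x r * vmu G x).
have splitE (sg : R) r :
    \sum_(x <- D) (sg * eta L x * u x r + lam * entropy s (u x r)) * vmu G x =
    sg * F r + lam * \sum_(x <- D) entropy s (u x r) * vmu G x.
  rewrite /F !mulr_sumr -big_split/=; apply: eq_bigr => x _; ring.
(* The functional only grows slowly, which bounds the mass from above; applied to
   the opposite cutoff it bounds the mass from below. *)
have one_side (sg : R) : `|sg| = 1 -> sg * F t - sg * F 0 <= e.
  move=> sg1.
  have off x : ~ gball G x0 N%:R x -> sg * eta L x = 0.
    by move=> /offU ->; rewrite mulr0.
  have rem_sg r : 0 < r -> r < t -> 2^-1 * \sum_(x <- D) \sum_(y <- D)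
      (q / s * Num.max `|u x r| `|u y r| `^ (q - s) / lam) `^ (p - 1) *
      `|sg * eta L y - sg * eta L x| `^ p * G x y <= W.
    move=> r0 _; apply: le_trans (rem r r0); rewrite ler_pM2l ?invr_gt0//.
    apply: ler_sum => x _; apply: ler_sum => y _.
    by rewrite -mulrBr normrM sg1 mul1r.
  have := functional_growth p_gt1 s0 sq lam0 vmu_gt0 uD UnD sol off t0 rem_sg.
  rewrite !splitE.
  have := ler_wpM2l (ltW lam0) ent0.
  have := mulr_ge0 (ltW lam0) ent_ge0.
  lra.
have -> : \sum_(x <- E) eta L x * ((u x t - u0 x) * vmu G x) = F t - F 0.
  rewrite /F -sumrB.
  rewrite (eq_sum_support uE uD) => [|x /offE ->|x xD]; first last.
  - by rewrite offU ?mul0r// => /UD; apply/negP.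
  - by rewrite mul0r.
  apply: eq_bigr => x _; rewrite -mulrBr -mulrBl.
  have [_ _ init _] := sol.
  by have [/init ->//|/offU ->] := pselect (gball G x0 N%:R x); rewrite !mul0r.
have := one_side 1 (normr1 _); have := one_side (-1) (normrN1 _).
by move=> h1 h2; rewrite ler_norml; apply/andP; split; lra.
Qed.

Lemma mixed_l1_any N u (E : seq V) t : 0 <= t -> uniq E ->
  is_mixed_solution G p q (gball G x0 N%:R) u0 u ->
  \sum_(x <- E) `|u x t| * vmu G x <= S.
Proof.
move=> t0 uE sol.
have [D [uD UD UnD]] := ball_nbh_enum N.
have ge0 x : 0 <= `|u x t| * vmu G x by rewrite mulr_ge0 ?vmu_ge0.
apply: (@le_trans _ _ (\sum_(x <- undup (E ++ D)) `|u x t| * vmu G x)).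
  by apply: ler_sum_subset => // x xE; rewrite mem_undup mem_cat xE.
rewrite (eq_sum_support (undup_uniq _) uD) => [|x|x xD].
- exact: (mixed_l1_le p_gt1 q_gt0 mu0_gt0 (inf_vmu_le G) uD UnD sol u0_l1).
- rewrite mem_undup mem_cat negb_or => /andP[_ xD].
  have [_ _ _ off] := sol; rewrite off ?normr0 ?mul0r// => /UD; exact/negP.
- have [_ _ _ off] := sol; rewrite off ?normr0 ?mul0r// => /UD; exact/negP.
Qed.

(** The solution enters only through its values at times [0] and [t]: the mass
    defect of the approximations inside the support of a cutoff is a finite sum,
    which passes to the pointwise limit, and the cutoff is then removed. *)
Lemma exhaustion_mass u (t : R) :
  is_exhaustion_solution G p q x0 1 u0 u -> 0 < t -> vsum G (u^~ t) = vsum G u0.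
Proof.
move=> [_ [n [un [n_incr _ un_sol un_cvg]]]] t0.
have n_ge k : (k <= n k)%N.
  by elim: k => // k /leq_ltn_trans; apply; exact: n_incr.
have ut_l1 E : uniq E -> \sum_(x <- E) `|u x t| * vmu G x <= S.
  move=> uE.
  have H : \sum_(x <- E) `|un k x t| * vmu G x @[k --> \oo] -->
      \sum_(x <- E) `|u x t| * vmu G x.
    apply: cvg_sum_seq => x; apply: cvgMl; apply: cvg_norm.
    exact: un_cvg (ltW t0).
  apply: (cvgr_to_le H).
  by near=> k; apply: mixed_l1_any (un_sol k) => //; exact: ltW.
have [F FE Flim] := vsum_cutoff_limit rho ut_l1.
have [F0 F0E F0lim] := vsum_cutoff_limit rho u0_l1.
rewrite FE F0E; congr _%:E; apply/eqP; rewrite -subr_eq0 -normr_le0.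
apply/ler_addgt0Pr => e e0; rewrite add0r.
have e30 : 0 < e / 3 by rewrite divr_gt0.
have [L1 H1] := Flim _ e30; have [L2 H2] := F0lim _ e30.
have [L3 H3] := mixed_mass_defect t0 e30.
pose L := (maxn L1 (maxn L2 L3)).+1.
have L1L : (L1 < L)%N by rewrite ltnS leq_max leqnn.
have L2L : (L2 < L)%N by rewrite ltnS !leq_max leqnn orbT.
have L3L : (L3 < L)%N by rewrite ltnS !leq_max leqnn !orbT.
have [E [uE inE']] := @ball_enum (expR L%:R) (expR_ge0 _).
have offE x : x \notin E -> eta L x = 0.
  move=> xE; apply: log_cutoff_eq0 => //.
  have : ~ (rho x)%:R <= expR L%:R :> R by move/inE'; exact/negP.
  by move=> /negP; rewrite -ltNge; lra.
have D : `|\sum_(x <- E) eta L x * ((u x t - u0 x) * vmu G x)| <= e / 3.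
  have H : `|\sum_(x <- E) eta L x * ((un k x t - u0 x) * vmu G x)| @[k --> \oo]
      --> `|\sum_(x <- E) eta L x * ((u x t - u0 x) * vmu G x)|.
    apply: cvg_norm; apply: cvg_sum_seq => x; apply: cvgMr; apply: cvgMl.
    by apply: cvgB; [exact: un_cvg (ltW t0)|exact: cvg_cst].
  apply: (cvgr_to_le H); near=> k.
  apply: (H3 L (n k) (un k)) => //.
  apply: (@le_trans _ _ (Num.truncn (expR L%:R : R)).+1%:R).
    by apply: ltW; exact: truncnS_gt.
  rewrite -natr1 addrC lerD2l ler_nat (leq_trans _ (n_ge k))//.
  by near: k; exact: nbhs_infty_ge.
have DE : \sum_(x <- E) eta L x * ((u x t - u0 x) * vmu G x) =
    \sum_(x <- E) eta L x * (u x t * vmu G x) -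
    \sum_(x <- E) eta L x * (u0 x * vmu G x).
  by rewrite -sumrB; apply: eq_bigr => x _; ring.
have := H1 L E L1L uE offE; have := H2 L E L2L uE offE; move: D; rewrite DE.
rewrite !ler_norml => /andP[? ?] /andP[? ?] /andP[? ?].
by apply/andP; split; lra.
Unshelve. all: by end_near.
Qed.

End Conservation.

Lemma in_l1_bound (R : realType) (V : countType) (G : weighted_graph R V)
    (f : V -> R) : in_lr G 1 f ->
  exists S : R, forall E : seq V, uniq E ->
    \sum_(x <- E) `|f x| * vmu G x <= S.
Proof.
rewrite /in_lr /lr_norm invr1.
have ge0 : (0 <= \esum_(x in [set: V]) (`|f x| `^ 1 * vmu G x)%:E)%E.
  by apply: esum_ge0 => x _; rewrite lee_fin mulr_ge0 ?powR_ge0 ?vmu_ge0.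
rewrite poweRe1// => fin.
exists (fine (\esum_(x in [set: V]) (`|f x| `^ 1 * vmu G x)%:E)) => E uE.
rewrite -lee_fin fineK ?ge0_fin_numE//.
under eq_bigr do rewrite -[`|f _|]powRr1//.
apply: (@fsets_sum_le_esum _ _ _ (fun x => `|f x| `^ 1 * vmu G x)) => // x.
by rewrite mulr_ge0 ?powR_ge0 ?vmu_ge0.
Qed.

Unset Implicit Arguments.

Theorem theorem1p5 (R : realType) (V : countType) (G : weighted_graph R V)
    (Vinf : infinite_set [set: V]) (Gconn : connected_graph G)
    (mu0_gt0 : 0 < inf (range (vmu G))) (x0 : V)
    (p q : R) (p_gt1 : 1 < p) (q_gt0 : 0 < q)
    (C d : R) (C_gt0 : 0 < C) (d_gt0 : 0 < d)
    (volume_growth : forall r : R, 0 <= r ->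
       (vmu_set G (gball G x0 r) <= (C * (1 + r) `^ d)%:E)%E)
    (pq_cond : (d - p) / d <= q * (p - 1))
    (u0 : V -> R) (u0_l1 : in_lr G 1 u0)
    (u : V -> R -> R) (u_sol : is_exhaustion_solution G p q x0 1 u0 u) :
  forall t : R, 0 < t -> vsum G (u^~ t) = vsum G u0.
Proof.
move=> t t0.
have [rho [rho_ball rho_lip]] := exists_depth x0 Gconn.
have [S u0S] := in_l1_bound u0_l1.
exact: (exhaustion_mass rho_lip rho_ball C_gt0 d_gt0 p_gt1 q_gt0 mu0_gt0
  volume_growth pq_cond u0S u_sol t0).
Qed.
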